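(* Let $\mathcal{C}\subseteq\mathsf{RPD}_{m,n}$ be a union of full subcrystals of $\mathsf{RPD}_{m,n}$. Suppose $i\in[n-1]$ and $w\in S_n$ satisfy $w(i)<w(i+1)$. Then $$\mathcal{C}_{ws_i}=\mathfrak{D}_i(\mathcal{C}_w)\quad\text{and}\quad \mathsf{ch}(\mathcal{C}_{ws_i})=\pi^K_i(\mathsf{ch}(\mathcal{C}_w)).$$
   Context: Permutations compose as functions, $s_k=(k,k+1)$. $\mathsf{RPD}_{m,n}$ is the set of $n\times m$ arrays (rows $1..n$ top to bottom, columns $1..m$) of tiles, each a bump tile (pipe from left edge to top edge and pipe from bottom edge to right edge) or a crossing tile. The pipe entering the left of row $r$ is labeled $r$, the pipe entering the bottom of column $j$ is labeled $n+j$; in a bump tile the left label exits at the top and the bottom label at the right; in a crossing tile with left label $a$ and bottom label $b$, $\max(a,b)$ exits at the top, $\min(a,b)$ at the right. $\sigma_D\in S_{m+n}$ has one-line notation: top-edge labels left to right, then right-edge labels top to bottom. For $v\in S_n$, $1^m\times v\in S_{m+n}$ fixes $[m]$ and sends $m+i\mapsto m+v(i)$; $S_n\subseteq S_{m+n}$ permutes $\{1,\dots,n\}$. $\bar\sigma_D$ is the unique element of $\{u\sigma_D(1^m\times v^{-1}):u,v\in S_n\}$ with $\bar\sigma_D^{-1}(1)>\dots>\bar\sigma_D^{-1}(n)$ and $\bar\sigma_D(m+1)>\dots>\bar\sigma_D(m+n)$. Crystal structure: $\mathbf{e}_k$ standard basis of $\mathbb{Z}^n$. For $T\subseteq[n]$,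 $\mathrm{wt}(T)=\sum_{j\in T}\mathbf{e}_j$, $e_i(T)=T\cup\{i\}$ if $T\cap\{i,i+1\}=\{i+1\}$, $T\setminus\{i+1\}$ if $T\cap\{i,i+1\}=\{i,i+1\}$, else $0$; $f_i(T)=T\cup\{i+1\}$ if $T\cap\{i,i+1\}=\{i\}$, $T\setminus\{i\}$ if $T\cap\{i,i+1\}=\{i,i+1\}$, else $0$. With $\varepsilon_i,\varphi_i$ the maximal numbers of applications of $e_i,f_i$ before reaching $0$, tensor products have additive weight, $e_i(b\otimes c)=b\otimes e_i(c)$ if $\varepsilon_i(b)\le\varphi_i(c)$ else $e_i(b)\otimes c$, $f_i(b\otimes c)=b\otimes f_i(c)$ if $\varepsilon_i(b)<\varphi_i(c)$ else $f_i(b)\otimes c$, $b\otimes0=0\otimes c=0$. $m$-tuples of subsets of $[n]$ form a crystal via $S\leftrightarrow S_1\otimes\cdots\otimes S_m$, transported to $\mathsf{RPD}_{m,n}$ via the bijection whose tile at row $r$, column $j$ is a bump tile iff $r\in S_j$; thus $\mathrm{wt}(D)_r$ is the number of bump tiles in row $r$. Full subcrystals are weakly connected components of the graph with edges $D\to f_i(D)\ne0$. $\le$ is the (strong) Bruhat order on $S_n$. For $w\in S_n$, $\mathcal{C}_w=\{c\in\mathcal{C}:\sigma_c=u\,\bar\sigma_c\,(1^m\times v)\text{ for some }u,v\in S_n\text{ with }v\le w\}$ and $\mathsf{ch}(\mathcal{C}_w)=\sum_{c\in\mathcal{C}_w}x^{\mathrm{wt}(c)}$, $x^\alpha=x_1^{\alpha_1}\cdots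 x_n^{\alpha_n}$. For $X\subseteq\mathcal{C}$, $\mathfrak{D}_i(X)=\{b\in\mathcal{C}:e_i^k(b)\in X\text{ for some }k\in\mathbb{N}\}$. On $\mathbb{Z}[x_1,\dots,x_n]$, $\partial_i(f)=\frac{f-s_if}{x_i-x_{i+1}}$ where $s_if$ swaps $x_i,x_{i+1}$, and $\pi^K_i(f)=\partial_i((1+x_{i+1})x_if)$. *)

(* Defs.v *)
From HB Require Import structures.
From mathcomp Require Import all_boot all_order all_fingroup all_algebra.
From mathcomp.multinomials Require Import mpoly.

Set Implicit Arguments.
Unset Strict Implicit.
Unset Printing Implicit Defensive.

Import GRing.Theory.

(* Rows, columns, pipe labels and crystal indices are counted from 0: [n] is
   'I_n, [n-1] is 'I_n.-1, and the pipe labels 1, ..., m+n are 0, ..., m+n-1. *)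

Section Permutations.

(* The group law of {perm T} applies its left factor first; perm_comp is the
   composition of permutations as functions. *)
Definition perm_comp (T : finType) (u v : {perm T}) : {perm T} := (v * u)%g.

Lemma perm_compE (T : finType) (u v : {perm T}) x : perm_comp u v x = u (v x).
Proof. exact: permM. Qed.

Definition low n (i : 'I_n.-1) : 'I_n := widen_ord (leq_pred n) i.

Fact high_subproof n (i : 'I_n.-1) : i.+1 < n.
Proof. by rewrite -ltn_predRL. Qed.

Definition high n (i : 'I_n.-1) : 'I_n := Ordinal (high_subproof i).

Definition simple_refl n (i : 'I_n.-1) : 'S_n := tperm (low i) (high i).

Definition perm_length n (w : 'S_n) : nat :=
  #|[set p : 'I_n * 'I_n | (p.1 < p.2) && (w p.2 < w p.1)]|.

Definition bruhat_step n : rel 'S_n := fun v w =>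
  [exists a : 'I_n, [exists b : 'I_n,
    (w == perm_comp v (tperm a b)) && (perm_length v < perm_length w)]].

Definition bruhat n : rel 'S_n := connect (@bruhat_step n).

Definition sum_fun a b (u : 'S_a) (v : 'S_b) (k : 'I_(a + b)) : 'I_(a + b) :=
  match split k with
  | inl x => lshift b (u x)
  | inr y => rshift a (v y)
  end.

Fact sum_fun_inj a b (u : 'S_a) (v : 'S_b) : injective (sum_fun u v).
Proof.
apply: (can_inj (g := sum_fun u^-1%g v^-1%g)) => k; rewrite /sum_fun.
case: (split_ordP k) => j ->.
  case: (split_ordP (lshift b (u j))) => j' /eqP.
    by rewrite eq_lshift => /eqP <-; rewrite permK.
  by rewrite eq_lrshift.
case: (split_ordP (rshift a (v j))) => j' /eqP.
  by rewrite eq_rlshift.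
by rewrite eq_rshift => /eqP <-; rewrite permK.
Qed.

(* The block permutation u x v of [a + b]. *)
Definition perm_sum a b (u : 'S_a) (v : 'S_b) : 'S_(a + b) :=
  perm (@sum_fun_inj a b u v).

(* 1^m x v *)
Definition shift_perm m n (v : 'S_n) : 'S_(m + n) := perm_sum (1%g : 'S_m) v.

(* u in S_n viewed in S_{m+n} as permuting {1, ..., n}. *)
Definition incl_perm m n (u : 'S_n) : 'S_(m + n) :=
  cast_perm (addnC n m) (perm_sum u (1%g : 'S_m)).

(* k in [n] viewed in [m+n]. *)
Definition incl_ord m n (k : 'I_n) : 'I_(m + n) :=
  cast_ord (addnC n m) (lshift m k).

Lemma shift_permL m n (v : 'S_n) (k : 'I_m) :
  shift_perm m v (lshift n k) = lshift n k.
Proof. by rewrite permE /sum_fun (unsplitK (inl k)) perm1. Qed.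

Lemma shift_permR m n (v : 'S_n) (k : 'I_n) :
  shift_perm m v (rshift m k) = rshift m (v k).
Proof. by rewrite permE /sum_fun (unsplitK (inr k)). Qed.

Lemma incl_permE m n (u : 'S_n) (k : 'I_n) :
  incl_perm m u (incl_ord m k) = incl_ord m (u k).
Proof.
rewrite cast_permE cast_ordK permE /sum_fun (unsplitK (inl k)).
exact: val_inj.
Qed.

Lemma incl_perm_id m n (u : 'S_n) (k : 'I_(m + n)) :
  n <= k -> incl_perm m u k = k.
Proof.
move=> le_nk; rewrite cast_permE permE /sum_fun.
case: (split_ordP (cast_ord (esym (addnC n m)) k)) => j jE.
  by move: (congr1 val jE) le_nk => /= ->; rewrite leqNgt ltn_ord.
by rewrite perm1 -jE cast_ordKV.
Qed.

End Permutations.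

Section PipeDreams.

Variables m n : nat.

(* D r j is true iff the tile in row r and column j is a bump tile. *)
Definition RPD : finType := 'M[bool]_(n, m).

(* row_pass a row sends the pipe labeled a from the left edge through a row
   given, left to right, by its tiles and their bottom labels; it returns the
   labels on the top edges and the label on the right edge of the row. *)
Fixpoint row_pass (a : nat) (row : seq (bool * nat)) : seq nat * nat :=
  match row with
  | [::] => ([::], a)
  | (bump, b) :: row' =>
      let: (top, east) := if bump then (a, b) else (maxn a b, minn a b) in
      let: (tops, out) := row_pass east row' in
      (top :: tops, out)
  end.

(* The state is the pair of the labels on the bottom edges of row r, left to
   right, and of the labels on the right edges of the rows below r, top to
   bottom. *)
Definition grid_step (D : RPD) (r : 'I_n) (st : seq nat * seq nat) :
    seq nat * seq nat :=
  let: (tops, out) := row_pass r (zip [seq D r j | j <- enum 'I_m] st.1) in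
  (tops, out :: st.2).

Definition oneline (D : RPD) : seq nat :=
  let: (tops, rights) := foldr (grid_step D) (iota n m, [::]) (enum 'I_n) in
  tops ++ rights.

Lemma row_pass_perm a row :
  perm_eq ((row_pass a row).2 :: (row_pass a row).1) (a :: unzip2 row) /\
  size (row_pass a row).1 = size row.
Proof.
elim: row a => [|[bump b] row IH] a //=.
set p := (if bump then _ else _).
have: perm_eq [:: p.1; p.2] [:: a; b].
  rewrite {}/p; case: bump => //=; case: (leqP a b) => _ //=.
  by apply/seq.permP => q /=; rewrite !addn0 addnC.
case: p => top east /= pP; have [] := IH east.
case: (row_pass east row) => tops out /= IHp -> ; split=> //.
rewrite -(perm_cat2l [:: top]) in IHp.
rewrite (@perm_trans _ [:: top, east & unzip2 row]) //.
  apply: perm_trans IHp; apply/seq.permP => q /=; by rewrite addnCA.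
by rewrite -(perm_cat2r (unzip2 row)) in pP.
Qed.

Lemma oneline_perm (D : RPD) : perm_eq (oneline D) (iota 0 (m + n)).
Proof.
rewrite /oneline.
have: perm_eq (map val (enum 'I_n) ++ iota n m) (iota 0 (m + n)).
  by rewrite val_enum_ord addnC iotaD.
move=> /(perm_trans _); move: (enum 'I_n) => s; apply.
suff: let st := foldr (grid_step D) (iota n m, [::]) s in
      perm_eq (st.1 ++ st.2) (map val s ++ iota n m) /\ size st.1 = m.
  by case: (foldr _ _ _) => tops rights /= [].
elim: s => [|r s /=]; first by rewrite /= cats0 size_iota.
case: (foldr _ _ s) => bots rights /= [IH szb]; rewrite /grid_step /=.
set row := zip _ _.
have szr: size [seq D r j | j <- enum 'I_m] = size bots.
  by rewrite size_map size_enum_ord.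
have [] := row_pass_perm r row; rewrite /row unzip2_zip ?szr // size2_zip ?szr //.
case: (row_pass _ _) => tops out /= pP szt; split; last by rewrite szt.
rewrite -(perm_cons (val r)) in IH; apply: perm_trans IH.
rewrite -cat_cons; apply: perm_trans (_ : perm_eq ((out :: tops) ++ rights) _).
  by rewrite -cat1s perm_catCA.
by rewrite perm_cat2r.
Qed.

Fact oneline_lt (D : RPD) (k : 'I_(m + n)) : nth 0 (oneline D) k < m + n.
Proof.
have sz := perm_size (oneline_perm D); rewrite size_iota in sz.
have /= := mem_nth 0 (_ : k < size (oneline D)).
by rewrite (perm_mem (oneline_perm D)) mem_iota sz add0n /= => ->.
Qed.

Definition sigma_fun (D : RPD) (k : 'I_(m + n)) : 'I_(m + n) :=
  Ordinal (oneline_lt D k).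

Fact sigma_fun_inj (D : RPD) : injective (sigma_fun D).
Proof.
have sz := perm_size (oneline_perm D); rewrite size_iota in sz.
move=> k l /(congr1 val) /= /eqP; rewrite nth_uniq ?sz //.
  by move/eqP/val_inj.
by rewrite (perm_uniq (oneline_perm D)) iota_uniq.
Qed.

Definition sigma (D : RPD) : 'S_(m + n) := perm (@sigma_fun_inj D).

Definition is_sigma_bar (D : RPD) (s : 'S_(m + n)) : bool :=
  [&& [exists u : 'S_n, [exists v : 'S_n,
         s == perm_comp (incl_perm m u) (perm_comp (sigma D) (shift_perm m v^-1%g))]],
      [forall a : 'I_n, [forall b : 'I_n, (a < b) ==>
         (s^-1%g (incl_ord m b) < s^-1%g (incl_ord m a))]] &
      [forall a : 'I_n, [forall b : 'I_n, (a < b) ==>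
         (s (rshift m b) < s (rshift m a))]]].

Fact sigma_bar_exists (D : RPD) : exists s, is_sigma_bar D s.
Proof.
pose cost (s : 'S_(m + n)) := \sum_(k < m + n) k * s k.
have cost_lt (s : 'S_(m + n)) (p q : 'I_(m + n)) :
    p < q -> s p < s q -> cost (tperm p q * s)%g < cost s.
  move=> lt_pq lt_s; have neq_pq: q != p by rewrite neq_ltn lt_pq orbT.
  rewrite /cost (bigD1 p) // (bigD1 q) //= [X in _ < X](bigD1 p) //.
  rewrite [X in _ < _ + X](bigD1 q) //= !permM tpermL tpermR.
  rewrite (eq_bigr (fun k : 'I_(m + n) => k * s k)) => [|k]; last first.
    by case/andP=> kp kq; rewrite permM tpermD // eq_sym.
  rewrite !addnA ltn_add2r -(subnKC (ltnW lt_pq)) -(subnKC (ltnW lt_s)).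
  rewrite !mulnDl !mulnDr -!addnA ltn_add2l addnCA ltn_add2l ltn_add2l.
  by rewrite -[X in X < _]addn0 ltn_add2l muln_gt0 !subn_gt0 lt_pq.
pose P s := [exists u : 'S_n, [exists v : 'S_n,
  s == perm_comp (incl_perm m u) (perm_comp (sigma D) (shift_perm m v^-1%g))]].
have inclM (u v : 'S_n) : incl_perm m (perm_comp u v) =
    perm_comp (incl_perm m u) (incl_perm m v).
  apply/permP => k; rewrite perm_compE; have [le_nk|lt_kn] := leqP n k.
    by rewrite !incl_perm_id.
  have ->: k = incl_ord m (Ordinal lt_kn) by apply: val_inj.
  by rewrite !incl_permE perm_compE.
have shiftM (u v : 'S_n) : shift_perm m (perm_comp u v) =
    perm_comp (shift_perm m u) (shift_perm m v).
  apply/permP => k; rewrite perm_compE; case: (split_ordP k) => j ->.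
    by rewrite !shift_permL.
  by rewrite !shift_permR perm_compE.
have incl1 : incl_perm m (1%g : 'S_n) = 1%g.
  by apply: (mulIg (incl_perm m 1%g)); rewrite -[LHS]inclM /perm_comp !mul1g.
have shift1 : shift_perm m (1%g : 'S_n) = 1%g.
  by apply: (mulIg (shift_perm m 1%g)); rewrite -[LHS]shiftM /perm_comp !mul1g.
have incl_inj : injective (@incl_ord m n).
  by move=> a b /(congr1 val) /= /val_inj.
have inclT (a b : 'I_n) :
    incl_perm m (tperm a b) = tperm (incl_ord m a) (incl_ord m b).
  apply/permP => k; have [le_nk|lt_kn] := leqP n k.
    rewrite incl_perm_id // tpermD //; apply: contraTneq le_nk => <-;
    by rewrite -ltnNge /= ltn_ord.
  have ->: k = incl_ord m (Ordinal lt_kn) by apply: val_inj.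
  by rewrite incl_permE -inj_tperm.
have shiftT (a b : 'I_n) :
    shift_perm m (tperm a b) = tperm (rshift m a) (rshift m b).
  apply/permP => k; case: (split_ordP k) => j ->.
    by rewrite shift_permL tpermD // eq_rlshift.
  by rewrite shift_permR -inj_tperm //; apply: rshift_inj.
have P0 : P (sigma D).
  apply/existsP; exists 1%g; apply/existsP; exists 1%g.
  by rewrite invg1 incl1 shift1 /perm_comp mulg1 mul1g.
have [s Ps s_min] := arg_minnP cost P0; exists s; apply/and3P; split=> //.
  apply/forallP=> a; apply/forallP=> b; apply/implyP=> lt_ab.
  rewrite ltnNge leq_eqVlt; apply/negP; case/orP=> [/eqP/val_inj/perm_inj/incl_inj|].
    by move=> eq_ab; rewrite eq_ab ltnn in lt_ab.
  move=> lt_s; have := cost_lt s _ _ lt_s; rewrite !permKV => /(_ lt_ab).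
  rewrite ltnNge s_min //.
  have -> : (tperm (s^-1 (incl_ord m a)) (s^-1 (incl_ord m b)) * s)%g =
      perm_comp (incl_perm m (tperm a b)) s.
    by rewrite inclT -tpermJ /perm_comp conjgE invgK !mulgA mulgKV.
  case/existsP: Ps => u /existsP[v /eqP ->]; apply/existsP.
  exists (perm_comp (tperm a b) u); apply/existsP; exists v.
  by rewrite inclM /perm_comp !mulgA.
apply/forallP=> a; apply/forallP=> b; apply/implyP=> lt_ab.
rewrite ltnNge leq_eqVlt; apply/negP.
case/orP=> [/eqP/val_inj/perm_inj/rshift_inj|].
  by move=> eq_ab; rewrite eq_ab ltnn in lt_ab.
move=> lt_s; have := cost_lt s (rshift m a) (rshift m b) _ lt_s.
rewrite /= ltn_add2l => /(_ lt_ab); rewrite ltnNge s_min // -shiftT.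
case/existsP: Ps => u /existsP[v /eqP ->]; apply/existsP.
exists u; apply/existsP; exists (perm_comp (tperm a b) v).
have -> : (perm_comp (tperm a b) v)^-1%g = perm_comp v^-1%g (tperm a b).
  by rewrite /perm_comp invMg tpermV.
by rewrite shiftM /perm_comp !mulgA.
Qed.

(* is_sigma_bar D holds for exactly one permutation, the element of maximal
   length in the double coset of sigma D. *)
Definition sigma_bar (D : RPD) : 'S_(m + n) := xchoose (sigma_bar_exists D).

End PipeDreams.

Section Crystals.

Variable n : nat.

(* None stands for 0. *)
Record crystal (B : finType) := Crystal {
  wt : B -> 'X_{1..n};
  e_op : 'I_n.-1 -> B -> option B;
  f_op : 'I_n.-1 -> B -> option B }.

Definition op_iter (B : finType) (g : B -> option B) (k : nat) (b : B) :
  option B := iter k (obind g) (Some b).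

(* The maximal number of applications of g before reaching 0. The iterates of g
   that precede 0 are pairwise distinct, so there are at most #|B| of them and
   the bound on k loses nothing. *)
Definition string_length (B : finType) (g : B -> option B) (b : B) : nat :=
  \max_(k < #|B|.+1 | op_iter g k b != None) k.

Definition eps (B : finType) (X : crystal B) i b := string_length (e_op X i) b.
Definition phi (B : finType) (X : crystal B) i b := string_length (f_op X i) b.

Definition set_e (i : 'I_n.-1) (T : {set 'I_n}) : option {set 'I_n} :=
  if T :&: [set low i; high i] == [set high i] then Some (low i |: T)
  else if T :&: [set low i; high i] == [set low i; high i] then
    Some (T :\ high i)
  else None.

Definition set_f (i : 'I_n.-1) (T : {set 'I_n}) : option {set 'I_n} :=
  if T :&: [set low i; high i] == [set low i] then Some (high i |: T)
  else if T :&: [set low i; high i] == [set low i; high i] then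
    Some (T :\ low i)
  else None.

Definition set_crystal : crystal {set 'I_n} :=
  Crystal (fun T : {set 'I_n} => \sum_(j in T) U_(j))%MM set_e set_f.

Definition tensor (B C : finType) (X : crystal B) (Y : crystal C) :
    crystal (B * C)%type :=
  Crystal (fun x => wt X x.1 + wt Y x.2)%MM
    (fun i x => if eps X i x.1 <= phi Y i x.2
                then omap (fun c => (x.1, c)) (e_op Y i x.2)
                else omap (fun b => (b, x.2)) (e_op X i x.1))
    (fun i x => if eps X i x.1 < phi Y i x.2
                then omap (fun c => (x.1, c)) (f_op Y i x.2)
                else omap (fun b => (b, x.2)) (f_op X i x.1)).

Definition transport (A B : finType) (to : A -> B) (from : B -> A)
    (X : crystal B) : crystal A :=
  Crystal (fun a => wt X (to a))
    (fun i a => omap from (e_op X i (to a)))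
    (fun i a => omap from (f_op X i (to a))).

(* S_1 (x) (S_2 (x) ( ... (x) S_m)); the empty product is the one-element
   crystal of weight 0, which is a unit for the tensor product. *)
Fixpoint tuple_crystal (m : nat) : crystal (m.-tuple {set 'I_n}) :=
  match m with
  | 0 => Crystal (fun=> 0%MM) (fun _ _ => None) (fun _ _ => None)
  | m'.+1 =>
      transport (fun S => (thead S, behead_tuple S))
                (fun x => cons_tuple x.1 x.2)
                (tensor set_crystal (tuple_crystal m'))
  end.

Variable m : nat.

Definition RPD_columns (D : RPD m n) : m.-tuple {set 'I_n} :=
  [tuple [set r | D r j] | j < m].

Definition RPD_of_columns (S : m.-tuple {set 'I_n}) : RPD m n :=
  (\matrix_(r, j) (r \in tnth S j))%R.

Definition RPD_crystal : crystal (RPD m n) :=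
  transport RPD_columns RPD_of_columns (tuple_crystal m).

Lemma RPD_columnsK : cancel RPD_columns RPD_of_columns.
Proof. by move=> D; apply/matrixP=> r j; rewrite mxE tnth_mktuple inE. Qed.

Lemma RPD_of_columnsK : cancel RPD_of_columns RPD_columns.
Proof.
by move=> S; apply: eq_from_tnth=> j; rewrite tnth_mktuple; apply/setP=> r;
   rewrite inE mxE.
Qed.

Definition crystal_edge : rel (RPD m n) := fun D D' =>
  [exists i, f_op RPD_crystal i D == Some D'].

Definition full_subcrystal (F : {set RPD m n}) : Prop :=
  exists D, F = [set D' | connect (relU crystal_edge
                                     (fun x y => crystal_edge y x)) D D'].

Definition union_of_full_subcrystals (C : {set RPD m n}) : Prop :=
  exists2 P : {set {set RPD m n}},
    (forall F, F \in P -> full_subcrystal F) & C = cover P.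

(* C_w *)
Definition sub_w (C : {set RPD m n}) (w : 'S_n) : {set RPD m n} :=
  [set c in C | [exists u : 'S_n, [exists v : 'S_n,
     (sigma c == perm_comp (incl_perm m u) (perm_comp (sigma_bar c) (shift_perm m v)))
     && bruhat v w]]].

(* For k beyond #|RPD m n| no new elements arise; see demazureP. *)
Definition demazure (C : {set RPD m n}) (i : 'I_n.-1) (X : {set RPD m n}) :
    {set RPD m n} :=
  [set b in C | [exists k : 'I_(#|RPD m n|.+1),
     if op_iter (e_op RPD_crystal i) k b is Some b' then b' \in X else false]].

Lemma demazureP (C : {set RPD m n}) i (X : {set RPD m n}) b :
  reflect (b \in C /\ exists k b',
             op_iter (e_op RPD_crystal i) k b = Some b' /\ b' \in X)
          (b \in demazure C i X).
Proof.
rewrite inE; apply: (iffP andP) => -[Cb].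
  case/existsP=> k; case E: (op_iter _ _ _) => [b'|] // Xb'.
  by split=> //; exists k, b'.
case=> k [b' [E Xb']]; split=> //; apply/existsP.
set g := obind (e_op RPD_crystal i) in E *.
have: fconnect g (Some b) (Some b') by rewrite -E fconnect_iter.
move/iter_findex; set k' := findex _ _ _ => E'.
have lt_k' : k' < #|RPD m n|.+1.
  have: fconnect g (Some b) (Some b') by rewrite -E fconnect_iter.
  move/findex_max => lt; apply: leq_trans lt _.
  by rewrite -card_option max_card.
by exists (Ordinal lt_k'); rewrite /op_iter /= -/g E'.
Qed.

Definition ch (X : {set RPD m n}) : {mpoly int[n]} :=
  (\sum_(c in X) 'X_[wt RPD_crystal c])%R.

End Crystals.

Section DividedDifferences.

Variable n : nat.
Local Open Scope ring_scope.

Fact divided_diff_exists (i : 'I_n.-1) (f : {mpoly int[n]}) :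
  exists g : {mpoly int[n]},
    g * ('X_(low i) - 'X_(high i)) == f - msym (simple_refl i) f.
Proof.
set s := simple_refl i; set d := _ - _.
pose Q (f : {mpoly int[n]}) :=
  exists g : {mpoly int[n]}, g * d == f - msym s f.
have QM (p q : {mpoly int[n]}) : Q p -> Q q -> Q (p * q).
  case=> g /eqP gE [h /eqP hE]; exists (g * q + msym s p * h); apply/eqP.
  by rewrite mulrDl mulrAC gE -mulrA hE msymM mulrBl mulrBr addrA subrK.
have Q1 : Q 1 by exists 0; rewrite mul0r msym1 subrr.
have QX j : Q 'X_j.
  have sX : msym s 'X_j = 'X_(s j) :> {mpoly int[n]}.
    rewrite msymX; congr 'X_[_]; apply/mnmP=> k.
    by rewrite mnmE !mnm1E (can2_eq (permK s) (permKV s)).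
  rewrite /Q sX /s /simple_refl; case: tpermP => [->|->|_ _].
  - by exists 1; rewrite mul1r.
  - by exists (- 1); rewrite mulN1r opprB.
  - by exists 0; rewrite mul0r subrr.
rewrite -/(Q f); elim/mpolyind: f => [|c k p _ _ [h /eqP hE]].
  by exists 0; rewrite mul0r msym0 subrr.
have [g /eqP gE] : Q 'X_[k].
  rewrite mpolyXE_id; apply: (big_ind Q) => // j _.
  by elim: (k j) => [|e IH]; rewrite ?expr0 ?exprS //; apply: QM.
exists (c *: g + h); rewrite mulrDl -scalerAl gE hE msymD msymZ.
by rewrite scalerBr opprD addrACA.
Qed.

(* The quotient (f - s_i f) / (x_i - x_{i+1}), which lies in Z[x_1, ..., x_n]
   and is unique since the latter is an integral domain. *)
Definition divided_diff (i : 'I_n.-1) (f : {mpoly int[n]}) : {mpoly int[n]} :=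
  xchoose (divided_diff_exists i f).

Definition piK (i : 'I_n.-1) (f : {mpoly int[n]}) : {mpoly int[n]} :=
  divided_diff i ((1 + 'X_(high i)) * 'X_(low i) * f).

End DividedDifferences.

(* Main.v *)
Require Import Defs.
From mathcomp Require Import all_boot all_order all_fingroup all_algebra.
From mathcomp Require Import zify ring.
From mathcomp.multinomials Require Import mpoly.

Set Implicit Arguments.
Unset Strict Implicit.
Unset Printing Implicit Defensive.

Import GRing.Theory.

(** Modulo left multiplication by S_n, the permutation sigma_D is computed by
    the same dynamics with all labels at most n identified with one minimal
    label 0. By the signature rule, f_i changes a single column of the rows i
    and i+1, and following the two labels in these rows from left to right shows
    that f_i preserves the labels on top of them. It also preserves the labels
    leaving rows i and i+1 on the right, except that at the head of an i-string,
    where the upper label is at least the lower one, they may be exchanged.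
    Hence, along an i-string, the right factors v of sigma_D are either constant
    or multiplied by s_i when leaving the head. With the lifting property of the
    Bruhat order, C_(w s_i) is a union of i-strings and C_w meets each of them in
    everything or in the head alone. The character of an i-string is the image
    under pi^K_i both of the weight of its head and of itself. *)

(** * Bruhat order *)

Lemma ltn_tperm n (a b x y : 'I_n) : a < b -> x < y ->
  tperm a b y < tperm a b x ->
  [\/ x = a /\ y = b, x = a /\ y < b | a < x /\ y = b].
Proof.
have vn (u v : 'I_n) : u <> v -> (u : nat) != v by move/eqP.
move=> ltab ltxy; case: tpermP => [ya|yb|/vn nya /vn nyb];
  case: tpermP => [xa|xb|/vn nxa /vn nxb]; subst => lt; try lia.
- by constructor 1.
- by constructor 3.
- by constructor 2.
Qed.

(** Inversions of [v] inject into those of [v'] other than [(a, b)]: a pair is moved by the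
    transposition when this keeps it increasing, and is left in place otherwise. *)
Lemma perm_length_tperm n (v : 'S_n) (a b : 'I_n) : a < b -> v a < v b ->
  perm_length v < perm_length (perm_comp v (tperm a b)).
Proof.
move=> ltab ltv; pose t : {perm 'I_n} := tperm a b; set v' := perm_comp v t.
have v'E (x : 'I_n) : v' (t x) = v x by rewrite /v' perm_compE /t tpermK.
have v'a : v' a = v b by rewrite /v' perm_compE /t tpermL.
have v'b : v' b = v a by rewrite /v' perm_compE /t tpermR.
pose g (p : 'I_n * 'I_n) : 'I_n * 'I_n :=
  if t p.1 < t p.2 then (t p.1, t p.2) else p.
rewrite /perm_length; set A := [set _ | _]; set B := [set _ | _].
have tneq (x y : 'I_n) : x < y -> (t x < t y) = false -> t y < t x.
  move=> ltxy; have : t x != t y :> nat.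
    rewrite val_eqE (inj_eq perm_inj); apply: contraTneq ltxy => ->.
    by rewrite ltnn.
  by lia.
have ginj : {in A &, injective g}.
  move=> [x y] [x' y']; rewrite !inE /= => /andP[ltxy _] /andP[ltxy' _].
  rewrite /g /=; case: ifP => h; case: ifP => h' [e1 e2].
  - by rewrite (perm_inj e1) (perm_inj e2).
  - by move: (tneq _ _ ltxy' h'); rewrite -e1 -e2 /t !tpermK; lia.
  - by move: (tneq _ _ ltxy h); rewrite e1 e2 /t !tpermK; lia.
  - by rewrite e1 e2.
(* The image misses [(a, b)], itself an inversion of [v']; hence strictness. *)
rewrite -(card_in_imset ginj); apply: (@leq_trans #|B :\ (a, b)|.+1).
  rewrite ltnS; apply: subset_leq_card; apply/subsetP => z.
  case/imsetP=> -[x y]; rewrite inE /= => /andP[ltxy ltvyx] ->{z}.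
  rewrite /g /=; case: ifP => h.
    rewrite !inE /= h !v'E ltvyx !andbT; apply: contraTneq ltxy.
    case=> e1 e2; rewrite -(tpermK a b x) -(tpermK a b y) -/t e1 e2.
    by rewrite /t tpermL tpermR; lia.
  have lt := tneq _ _ ltxy h.
  have nab : (x, y) != (a, b).
    by apply: contraTneq ltvyx => -[-> ->]; lia.
  rewrite !inE nab ltxy /=.
  case: (ltn_tperm ltab ltxy lt) => [[e1 e2]|[e1 ltyb]|[ltax e2]].
  - by rewrite e1 e2 eqxx in nab.
  - have ya : y != a by rewrite -e1 -val_eqE /=; lia.
    have yb : y != b by rewrite -val_eqE /=; lia.
    move: ltvyx; rewrite e1 v'a /v' perm_compE /t tpermD ?(eq_sym a) ?(eq_sym b) //.
    by lia.
  - have xa : x != a by rewrite -val_eqE /=; lia.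
    have xb : x != b by rewrite -e2 -val_eqE /=; lia.
    move: ltvyx; rewrite e2 v'b /v' perm_compE /t tpermD ?(eq_sym a) ?(eq_sym b) //.
    by lia.
rewrite [X in _ <= X](cardsD1 (a, b)) inE /= ltab v'a v'b ltv; lia.
Qed.

Lemma bruhat_stepP n (v w : 'S_n) :
  reflect (exists a b : 'I_n, [/\ a < b, v a < v b &
             w = perm_comp v (tperm a b)])
          (bruhat_step v w).
Proof.
apply: (iffP idP); last first.
  case=> a [b [ltab ltv ->]]; apply/existsP; exists a; apply/existsP; exists b.
  by rewrite eqxx perm_length_tperm.
case/existsP=> a /existsP[b /andP[/eqP->]].
wlog ltab : a b / a < b => [IH|lt].
  case: (ltngtP a b) => [ltab|ltba|/val_inj ->]; first exact: IH.
    by rewrite tpermC; apply: IH.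
  by rewrite /perm_comp tperm1 mul1g ltnn.
exists a, b; split=> //; rewrite ltnNge leq_eqVlt val_eqE (inj_eq perm_inj).
apply/negP => /orP[/eqP e|ltba]; first by rewrite e ltnn in ltab.
have := @perm_length_tperm n (perm_comp v (tperm a b)) a b ltab.
rewrite !perm_compE tpermL tpermR => /(_ ltba).
rewrite /perm_comp mulgA tperm2 mul1g.
by move: lt; rewrite /perm_comp; lia.
Qed.

Lemma low_lt_high n (i : 'I_n.-1) : low i < high i.
Proof. by rewrite /=. Qed.

Lemma low_neq_high n (i : 'I_n.-1) : low i != high i.
Proof. by rewrite -val_eqE /=; lia. Qed.

Lemma simple_reflK n (i : 'I_n.-1) (w : 'S_n) :
  perm_comp (perm_comp w (simple_refl i)) (simple_refl i) = w.
Proof. by rewrite /perm_comp mulgA tperm2 mul1g. Qed.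

Lemma bruhat_simple n (i : 'I_n.-1) (w : 'S_n) : w (low i) < w (high i) ->
  bruhat w (perm_comp w (simple_refl i)).
Proof.
by move=> lt; apply/connect1/bruhat_stepP; exists (low i), (high i); split.
Qed.

(** Conjugation by [s] turns the reflection in [a < b] into the one in [s a] and [s b]. These are
    still increasing unless [a] and [b] are [low i] and [high i], when the step is multiplication by
    [s] itself. *)
Lemma bruhat_step_simple n (i : 'I_n.-1) (v w : 'S_n) : bruhat_step v w ->
  w = perm_comp v (simple_refl i) \/
  bruhat_step (perm_comp v (simple_refl i)) (perm_comp w (simple_refl i)).
Proof.
case/bruhat_stepP=> a [b [ltab ltv ->]].
set s := simple_refl i.
have [ltsab|] := boolP (s a < s b); last first.
  have : s a != s b :> nat.
    rewrite val_eqE (inj_eq perm_inj); apply: contraTneq ltab => ->.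
    by rewrite ltnn.
  move=> ne nlt; left; have lt : s b < s a by lia.
  case: (ltn_tperm (low_lt_high i) ltab lt) => [[-> ->] //|[]|[]].
    by move=> ea /= ltb; move: ltab; rewrite ea /=; lia.
  by move=> /= lta eb; move: ltab; rewrite eb /=; lia.
right; apply/bruhat_stepP; exists (s a), (s b); split=> //.
  by rewrite !perm_compE /s /simple_refl !tpermK.
rewrite -tpermJ conjgE /perm_comp /s /simple_refl tpermV -!mulgA.
by rewrite (mulgA (tperm (low i) (high i)) (tperm (low i) (high i)) v) tperm2 mul1g.
Qed.

(** Symmetric form of the lifting property, by induction on a chain from [v] to [w]. Multiplication
    by [s] carries each step to a step, except one from [v] to [x = v s]; there the statement for
    [x] bounds [v] or [v s] by [w s]. *)
Lemma bruhat_lift n (i : 'I_n.-1) (v w : 'S_n) : bruhat v w ->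
  let s := simple_refl i in
  bruhat (perm_comp v s) (perm_comp w s) \/
  bruhat (perm_comp v s) w /\ bruhat v (perm_comp w s).
Proof.
move=> /connectP[p pth ->] s; elim: p v pth => [|x p IH] v /=.
  by move=> _; left; apply: connect0.
case/andP=> step pth; have := IH x pth; set w' := last x p => IHx.
have vx := connect1 step.
case: (bruhat_step_simple i step) => [e|/connect1 stepS].
  rewrite -/s in e; move: IHx.
  have -> : perm_comp x s = v by rewrite e /s simple_reflK.
  rewrite -e => -[h|[h1 h2]]; last by left.
  by right; split=> //; apply/connectP; exists p.
case: IHx => [h|[h1 h2]]; first by left; apply: connect_trans stepS h.
by right; split; [apply: connect_trans stepS h1|apply: connect_trans vx h2].
Qed.

Section BruhatAscent.

Variables (n : nat) (i : 'I_n.-1) (w : 'S_n).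
Hypothesis asc : w (low i) < w (high i).
Let s := simple_refl i.

Lemma bruhat_ascent_stable (v : 'S_n) : bruhat v (perm_comp w s) ->
  bruhat (perm_comp v s) (perm_comp w s).
Proof.
move=> /(bruhat_lift i) /=; rewrite -/s /s simple_reflK => -[h|[h _] //].
exact: connect_trans h (bruhat_simple asc).
Qed.

Lemma bruhat_ascent_min (v : 'S_n) : bruhat v (perm_comp w s) ->
  bruhat v w \/ bruhat (perm_comp v s) w.
Proof.
move=> /(bruhat_lift i) /=; rewrite -/s /s simple_reflK.
by case=> [h|[_ h]]; [right|left].
Qed.

End BruhatAscent.

(** * Regular crystals *)

Section StringLength.

Variables (B : finType) (g : B -> option B) (F : B -> nat).
Hypothesis gN : forall b, g b = None -> F b = 0.
Hypothesis gS : forall b b', g b = Some b' -> F b = (F b').+1.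

Lemma op_iterS k b : op_iter g k.+1 b = obind g (op_iter g k b).
Proof. by []. Qed.

Lemma op_iter_level k b : k <= F b ->
  exists2 b', op_iter g k b = Some b' & F b = k + F b'.
Proof.
elim: k => [|k IH] lekb; first by exists b.
case: (IH (ltnW lekb)) => b' E Fb; rewrite op_iterS E /=.
case E' : (g b') => [b''|].
  by exists b'' => //; rewrite Fb (gS E') addnS.
by move: (gN E') => F0; rewrite Fb F0 addn0 ltnn in lekb.
Qed.

Lemma op_iter_None k b : F b < k -> op_iter g k b = None.
Proof.
elim: k => [|k IH] //; rewrite ltnS leq_eqVlt => /orP[/eqP e|lt].
  have [b' E Fb] := @op_iter_level k b (eq_leq (esym e)).
  rewrite op_iterS E /=; case E' : (g b') => [b''|] //.
  by move: (gS E'); lia.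
by rewrite op_iterS IH.
Qed.

(** A function that drops by one at each application of [g] and vanishes where [g] gives 0 counts
    the applications. *)
Lemma string_lengthE b : string_length g b = F b.
Proof.
(* [F] separates the iterates of index at most [F b], so the bound on [k] in [string_length] does
   not cut off the maximum. *)
have leFB : F b < #|B|.+1.
  pose h (k : 'I_(F b).+1) := odflt b (op_iter g k b).
  have hF (k : 'I_(F b).+1) : F b = k + F (h k).
    have [b' E Fb] := @op_iter_level k b (ltn_ord k).
    by rewrite [LHS]Fb /h E.
  have hinj : injective h.
    by move=> k l e; apply: val_inj => /=; move: (hF k) (hF l); rewrite e; lia.
  by have := leq_card h hinj; rewrite card_ord; lia.
apply/eqP; rewrite /string_length eqn_leq; apply/andP; split.
  apply/bigmax_leqP => k; case: (leqP k (F b)) => // lt.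
  by rewrite op_iter_None.
have [b' E _] := @op_iter_level (F b) b (leqnn _).
have h := @leq_bigmax_cond _ (fun k : 'I_#|B|.+1 => op_iter g k b != None)
            (fun k => k) (Ordinal leFB).
by apply: h; rewrite /= E.
Qed.

End StringLength.

Section Regular.

Variable n : nat.

(** The axioms of a seminormal crystal at a single index, without the weight. *)
Definition regular (B : finType) (X : crystal n B) (i : 'I_n.-1) :=
  [/\ forall b, f_op X i b = None -> phi X i b = 0,
      forall b b', f_op X i b = Some b' ->
        [/\ e_op X i b' = Some b, phi X i b = (phi X i b').+1 &
            eps X i b' = (eps X i b).+1],
      forall b, e_op X i b = None -> eps X i b = 0 &
      forall b b', e_op X i b = Some b' -> f_op X i b' = Some b].

(** Reduces regularity to guessing closed forms [E] and [F] of [eps] and [phi]. *)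
Lemma regularI (B : finType) (X : crystal n B) i (E F : B -> nat) :
  (forall b, f_op X i b = None -> F b = 0) ->
  (forall b b', f_op X i b = Some b' ->
     [/\ e_op X i b' = Some b, F b = (F b').+1 & E b' = (E b).+1]) ->
  (forall b, e_op X i b = None -> E b = 0) ->
  (forall b b', e_op X i b = Some b' -> f_op X i b' = Some b) ->
  [/\ regular X i, eps X i =1 E & phi X i =1 F].
Proof.
move=> fN fS eN eS.
have epsE : eps X i =1 E.
  move=> b; apply: string_lengthE => // {}b b' /eS /fS[_ _ ->] //.
have phiE : phi X i =1 F.
  by move=> b; apply: string_lengthE => // {}b b' /fS[_ -> _].
split=> //; split=> [b /fN|b b' /fS|b /eN|//]; rewrite ?epsE ?phiE //.
Qed.

Lemma regular_transport (A B : finType) (to : A -> B) (from : B -> A)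
    (X : crystal n B) i : cancel to from -> cancel from to -> regular X i ->
  [/\ regular (transport to from X) i,
      forall a, eps (transport to from X) i a = eps X i (to a) &
      forall a, phi (transport to from X) i a = phi X i (to a)].
Proof.
move=> toK fromK [fN fS eN eS]; apply: regularI => /=.
- by move=> a; case E: (f_op X i (to a)) => [b|] //= _; apply: fN.
- move=> a a'; case E: (f_op X i (to a)) => [b|] //= [<-].
  by rewrite fromK; have [-> -> ->] := fS _ _ E; rewrite /= toK.
- by move=> a; case E: (e_op X i (to a)) => [b|] //= _; apply: eN.
- move=> a a'; case E: (e_op X i (to a)) => [b|] //= [<-].
  by rewrite fromK (eS _ _ E) /= toK.
Qed.

(** The truncated differences count the brackets left after matching [eps] of the left factor
    against [phi] of the right one. After an operator has acted on a factor, the inverse operator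
    selects the same factor. *)
Lemma regular_tensor (B C : finType) (X : crystal n B) (Y : crystal n C) i :
  regular X i -> regular Y i ->
  [/\ regular (tensor X Y) i,
      forall x, eps (tensor X Y) i x =
        eps Y i x.2 + (eps X i x.1 - phi Y i x.2) &
      forall x, phi (tensor X Y) i x =
        phi X i x.1 + (phi Y i x.2 - eps X i x.1)].
Proof.
move=> [fN fS eN eS] [fN' fS' eN' eS']; apply: regularI => /=.
- case=> b c /=; case: (ltnP (eps X i b) (phi Y i c)) => h.
    by case E: (f_op Y i c) => [c'|] //= _; move: (fN' _ E); lia.
  by case E: (f_op X i b) => [b'|] //= _; move: (fN _ E); lia.
- case=> b c x' /=; case: (ltnP (eps X i b) (phi Y i c)) => h.
    case E: (f_op Y i c) => [c'|] //= [<-] /=.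
    have [-> phiE epsE] := fS' _ _ E; rewrite /= ifT; last by lia.
    by split=> //; lia.
  case E: (f_op X i b) => [b'|] //= [<-] /=.
  have [-> phiE epsE] := fS _ _ E; rewrite /= ifF; last by lia.
  by split=> //; lia.
- case=> b c /=; case: (leqP (eps X i b) (phi Y i c)) => h.
    by case E: (e_op Y i c) => [c'|] //= _; move: (eN' _ E); lia.
  by case E: (e_op X i b) => [b'|] //= _; move: (eN _ E); lia.
- case=> b c x' /=; case: (leqP (eps X i b) (phi Y i c)) => h.
    case E: (e_op Y i c) => [c'|] //= [<-] /=.
    have E' := eS' _ _ E; have [_ phiE epsE] := fS' _ _ E'.
    by rewrite E' /= ifT //; lia.
  case E: (e_op X i b) => [b'|] //= [<-] /=.
  have E' := eS _ _ E; have [_ phiE epsE] := fS _ _ E'.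
  by rewrite E' /= ifF //; lia.
Qed.

Lemma set_fE (i : 'I_n.-1) (T : {set 'I_n}) :
  set_f i T = if low i \in T then
                Some (if high i \in T then T :\ low i else high i |: T)
              else None.
Proof.
have lh := low_neq_high i; have hl : high i != low i by rewrite eq_sym.
have h1 : (T :&: [set low i; high i] == [set low i]) =
    (low i \in T) && (high i \notin T).
  apply/eqP/andP => [/setP E|[lT hT]].
    move: (E (low i)) (E (high i)); rewrite !inE !eqxx (negPf hl) ?orbT ?andbT /=.
    by move=> -> ->.
  apply/setP => x; rewrite !inE.
  have [->|nx] := eqVneq x (low i); first by rewrite lT.
  by have [->|_] := eqVneq x (high i); rewrite ?(negPf hT) ?andbF.
have h2 : (T :&: [set low i; high i] == [set low i; high i]) =
    (low i \in T) && (high i \in T).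
  rewrite -/(_ :==: _) setIC; apply/eqP/andP => [/setIidPl /subsetP E|[lT hT]].
    by split; apply: E; rewrite !inE eqxx ?orbT.
  by apply/setIidPl/subsetP => x; rewrite !inE => /orP[]/eqP->.
by rewrite /set_f h1 h2; case: (low i \in T) (high i \in T) => [] [].
Qed.

Lemma set_eE (i : 'I_n.-1) (T : {set 'I_n}) :
  set_e i T = if high i \in T then
                Some (if low i \in T then T :\ high i else low i |: T)
              else None.
Proof.
have lh := low_neq_high i; have hl : high i != low i by rewrite eq_sym.
have h1 : (T :&: [set low i; high i] == [set high i]) =
    (low i \notin T) && (high i \in T).
  apply/eqP/andP => [/setP E|[lT hT]].
    move: (E (low i)) (E (high i)); rewrite !inE !eqxx (negPf lh) ?orbT ?andbT /=.
    by move=> -> ->.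
  apply/setP => x; rewrite !inE.
  have [->|nx] := eqVneq x (low i); first by rewrite (negPf lT) (negPf lh).
  by have [->|_] := eqVneq x (high i); rewrite ?hT ?andbF.
have h2 : (T :&: [set low i; high i] == [set low i; high i]) =
    (low i \in T) && (high i \in T).
  rewrite -/(_ :==: _) setIC; apply/eqP/andP => [/setIidPl /subsetP E|[lT hT]].
    by split; apply: E; rewrite !inE eqxx ?orbT.
  by apply/setIidPl/subsetP => x; rewrite !inE => /orP[]/eqP->.
by rewrite /set_e h1 h2; case: (low i \in T) (high i \in T) => [] [].
Qed.

(** On the trace of [T] on rows i and i+1, f_i runs through {i}, {i, i+1}, {i+1} and then 0, so
    nontrivial strings have three elements. *)
Lemma regular_set (i : 'I_n.-1) :
  [/\ regular (set_crystal n) i,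
      forall T, eps (set_crystal n) i T =
        if high i \in T then (low i \notin T).+1 else 0 &
      forall T, phi (set_crystal n) i T =
        if low i \in T then (high i \notin T).+1 else 0].
Proof.
have lh := low_neq_high i; have hl : high i != low i by rewrite eq_sym.
apply: regularI => [T|T T'|T|T T'] /=; rewrite ?set_fE ?set_eE.
- by case: (low i \in T).
- case lT : (low i \in T) => // -[<-]; case hT : (high i \in T).
    by rewrite ?set_eE !inE !eqxx lT hT hl /= setD1K //.
  by rewrite ?set_eE !inE !eqxx lT hT ?(negPf hl) ?(negPf lh) /= setU1K ?hT //.
- by case: (high i \in T).
- case hT : (high i \in T) => // -[<-]; case lT : (low i \in T).
    by rewrite ?set_fE !inE !eqxx lT hT lh /= setD1K //.
  by rewrite ?set_fE !inE !eqxx lT hT ?(negPf hl) ?(negPf lh) /= setU1K ?lT //.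
Qed.

Lemma tuple_splitK m : cancel (fun S : m.+1.-tuple {set 'I_n} =>
                                 (thead S, behead_tuple S))
                              (fun x => cons_tuple x.1 x.2).
Proof. by move=> S; rewrite [RHS]tuple_eta; apply: val_inj. Qed.

Lemma tuple_consK m : cancel (fun x : {set 'I_n} * m.-tuple {set 'I_n} =>
                           cons_tuple x.1 x.2)
                        (fun S => (thead S, behead_tuple S)).
Proof. by case=> T S; congr (_, _); rewrite ?theadE //; apply: val_inj. Qed.

Lemma regular_tuple m (i : 'I_n.-1) : regular (tuple_crystal n m) i.
Proof.
elim: m => [|m IH].
  by case: (@regularI _ (tuple_crystal n 0) i (fun=> 0) (fun=> 0)).
have [rs _ _] := regular_set i.
have [rt _ _] := regular_tensor rs IH.
by have [] := regular_transport (@tuple_splitK m) (@tuple_consK m) rt.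
Qed.

Lemma behead_cons m (T : {set 'I_n}) (R : m.-tuple {set 'I_n}) :
  behead_tuple (cons_tuple T R) = R.
Proof. exact: val_inj. Qed.

(** Together with [phi_cons] and [f_cons], this unfolds the signature rule from the leftmost column
    on, the order in which pipes traverse a row. *)
Lemma eps_cons m (i : 'I_n.-1) T (R : m.-tuple {set 'I_n}) :
  eps (tuple_crystal n m.+1) i (cons_tuple T R) =
  eps (tuple_crystal n m) i R +
  (eps (set_crystal n) i T - phi (tuple_crystal n m) i R).
Proof.
have [rs _ _] := regular_set i.
have [rt epsE _] := regular_tensor rs (regular_tuple m i).
have [_ -> _] := regular_transport (@tuple_splitK m) (@tuple_consK m) rt.
by rewrite epsE /= theadE behead_cons.
Qed.

Lemma phi_cons m (i : 'I_n.-1) T (R : m.-tuple {set 'I_n}) :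
  phi (tuple_crystal n m.+1) i (cons_tuple T R) =
  phi (set_crystal n) i T +
  (phi (tuple_crystal n m) i R - eps (set_crystal n) i T).
Proof.
have [rs _ _] := regular_set i.
have [rt _ phiE] := regular_tensor rs (regular_tuple m i).
have [_ _ ->] := regular_transport (@tuple_splitK m) (@tuple_consK m) rt.
by rewrite phiE /= theadE behead_cons.
Qed.

Lemma f_cons m (i : 'I_n.-1) T (R : m.-tuple {set 'I_n}) :
  f_op (tuple_crystal n m.+1) i (cons_tuple T R) =
  if eps (set_crystal n) i T < phi (tuple_crystal n m) i R
  then omap (cons_tuple T) (f_op (tuple_crystal n m) i R)
  else omap (fun T' => cons_tuple T' R) (set_f i T).
Proof.
rewrite /= behead_cons theadE; case: ifP => _; first by case: (f_op _ _ _).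
by case: (set_f _ _).
Qed.

Lemma eps_tuple0 (i : 'I_n.-1) (S : 0.-tuple {set 'I_n}) :
  eps (tuple_crystal n 0) i S = 0.
Proof. by have [_ _ eN _] := regular_tuple 0 i; apply: eN. Qed.

Lemma phi_tuple0 (i : 'I_n.-1) (S : 0.-tuple {set 'I_n}) :
  phi (tuple_crystal n 0) i S = 0.
Proof. by have [fN _ _ _] := regular_tuple 0 i; apply: fN. Qed.

Lemma regular_RPD m (i : 'I_n.-1) :
  [/\ regular (RPD_crystal n m) i,
      forall D, eps (RPD_crystal n m) i D =
                eps (tuple_crystal n m) i (RPD_columns D) &
      forall D, phi (RPD_crystal n m) i D =
                phi (tuple_crystal n m) i (RPD_columns D)].
Proof.
exact: regular_transport (@RPD_columnsK n m) (@RPD_of_columnsK n m)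
  (regular_tuple m i).
Qed.

End Regular.

(** * Two adjacent rows *)

Section TwoRows.

Variables (n : nat) (i : 'I_n.-1).

(* p enters row i and q enters row i+1; the result consists of the labels on top
   of row i and of the labels leaving rows i and i+1, in this order. *)
Definition two_rows (p q : nat) (S : seq {set 'I_n}) (bs : seq nat) :
    seq nat * nat * nat :=
  let r2 := row_pass q (zip [seq high i \in T | T : {set 'I_n} <- S] bs) in
  let r1 := row_pass p (zip [seq low i \in T | T : {set 'I_n} <- S] r2.1) in
  (r1.1, r1.2, r2.2).

(** One column of rows i and i+1: [lo] and [hi] tell whether the upper and lower tiles are bumps,
    [b] is the label below them and [mid] the label between them. *)
Definition col_pass (lo hi : bool) (p q b : nat) : nat * nat * nat :=
  let mid := if hi then q else maxn q b in
  (if lo then p else maxn p mid, if lo then mid else minn p mid,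
   if hi then b else minn q b).

Definition cons_top (t : nat) (x : seq nat * nat * nat) :=
  (t :: x.1.1, x.1.2, x.2).

Arguments two_rows : simpl never.
Arguments cons_top : simpl never.

(** Replaces the row-by-row order of [two_rows] by a column-by-column one, matching the recursion on
    tensor factors. *)
Lemma two_rows_cons p q T S b bs :
  two_rows p q (T :: S) (b :: bs) =
  let c := col_pass (low i \in T) (high i \in T) p q b in
  cons_top c.1.1 (two_rows c.1.2 c.2 S bs).
Proof.
rewrite /cons_top /two_rows /col_pass /=; case: (high i \in T) => /=.
  case: (row_pass b _) => mids q' /=; case: (low i \in T) => /=;
  by case: (row_pass _ _).
case: (row_pass (minn q b) _) => mids q' /=; case: (low i \in T) => /=;
by case: (row_pass _ _).
Qed.

Definition same_or_swap (e : nat) (x y : seq nat * nat * nat) : Prop :=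
  x = y \/ [/\ e = 0, x.2 < x.1.2 & y = (x.1.1, x.2, x.1.2)].

Lemma same_or_swap_cons e t x y : same_or_swap e x y ->
  same_or_swap e (cons_top t x) (cons_top t y).
Proof. by case=> [->|[-> lt ->]]; [left|right]. Qed.

Let Ep m := eps (tuple_crystal n m) i.
Let Ph m := phi (tuple_crystal n m) i.

(** As [phi] is 0, the upper tile of the first column is a crossing. If the lower tile is a bump, or
    if [b < q], the outgoing labels do not depend on the order of [p] and [q]. Otherwise both tiles
    are crossings, the exchange passes to the next column unless the labels merge, and the column
    adds nothing to [eps]. *)
Lemma two_rows_swap_entry m (R : m.-tuple {set 'I_n}) p q bs :
  size bs = m -> Ph R = 0 -> q < p ->
  same_or_swap (Ep R) (two_rows p q R bs) (two_rows q p R bs).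
Proof.
have [_ epsS phiS] := regular_set i.
elim: m R p q bs => [|m IH] R p q bs szb.
  rewrite (tuple0 R) /Ep eps_tuple0; case: bs szb => // _ _ lt.
  by right; split.
case/tupleP: R => T R; case: bs szb => // b bs [szb].
rewrite /Ep /Ph eps_cons phi_cons !epsS !phiS [tval _]/= !two_rows_cons.
case: (low i \in T) => //; case: (high i \in T); rewrite /= ?subn0 ?add0n => h lt.
  rewrite /col_pass /= ![maxn q p]maxnC ![minn q p]minnC; left.
  by [].
have [ltbq|leqb] : b < q \/ q <= b by lia.
  left; rewrite /col_pass /=.
  have -> : maxn q (maxn p b) = maxn p (maxn q b) by lia.
  have -> : minn q (maxn p b) = minn p (maxn q b) by lia.
  by have -> : minn p b = minn q b by lia.
have -> : 0 - phi (tuple_crystal n m) i R = 0 by lia.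
rewrite addn0 /col_pass /=.
have -> : maxn q (maxn p b) = maxn p (maxn q b) by lia.
apply: same_or_swap_cons.
have -> : minn q (maxn p b) = minn q b by lia.
have -> : minn p (maxn q b) = minn p b by lia.
have [e|lt'] : minn p b = minn q b \/ minn q b < minn p b by lia.
  by rewrite e; left.
exact: IH.
Qed.

(* In the signature rule, e0 is the number of unmatched e_i-brackets of the
   columns to the left of S; f_i may act on S only if e0 < phi S. *)
Lemma two_rows_f m (S S' : m.-tuple {set 'I_n}) p q bs e0 :
  size bs = m -> (e0 = 0 -> q <= p) -> e0 < Ph S ->
  f_op (tuple_crystal n m) i S = Some S' ->
  same_or_swap (Ep S) (two_rows p q S bs) (two_rows p q S' bs).
Proof.
have lh := low_neq_high i; have hl : high i != low i by rewrite eq_sym.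
have [_ epsS phiS] := regular_set i.
elim: m S S' p q bs e0 => [|m IH] S S' p q bs e0 szb //.
case/tupleP: S => T R; case: bs szb => // b bs [szb] hpq.
rewrite f_cons /Ep /Ph eps_cons phi_cons !epsS !phiS.
case: (ltnP (if high i \in T then _ else _) (phi _ i R)) => cmp.
  case E: (f_op _ _ _) => [R'|] // lt /= [<-].
  rewrite [X in two_rows _ _ X _]/= [X in same_or_swap _ _ (two_rows _ _ X _)]/=.
  rewrite !two_rows_cons; set c := col_pass _ _ _ _ _.
  set a := (if high i \in T then _ else _) in lt cmp *.
  rewrite (eqP (ltnW cmp : a - _ == 0)) addn0.
  apply: (same_or_swap_cons (c.1.1)).
  (* The new [e0] is the count of unmatched e_i-brackets once [T] is included. *)
  apply: (IH _ _ _ _ _ (a + (e0 - (if low i \in T then (high i \notin T).+1 else 0))))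
    => //; last first.
    rewrite /Ph; move: lt cmp; move: (phi _ i R) => P; clearbody a.
    by clear; lia.
  (* A lower bump makes the new count positive. If only the upper tile is a bump, the lower crossing
     sorts the labels; if neither is, [e0] is unchanged and the order persists. *)
  rewrite /c /col_pass /a; case: (high i \in T) => //.
  case: (low i \in T) => /=; first by lia.
  by rewrite add0n subn0 => /hpq; lia.
rewrite set_fE; case lT : (low i \in T) => //= lt [<-].
rewrite [X in two_rows _ _ X _]/= [X in same_or_swap _ _ (two_rows _ _ X _)]/=.
case hT : (high i \in T) cmp lt => /= cmp lt.
  (* The upper bump becomes a crossing; here [e0 = 0], so [q <= p] and the crossing acts like the
     bump. *)
  left; rewrite !two_rows_cons !inE !eqxx lT hT hl /col_pass /=.
  have leqp : q <= p.
    by apply: hpq; move: lt cmp; rewrite lT /=; move: (phi _ i R) => P; lia.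
  by rewrite (minn_idPr leqp) (maxn_idPl leqp).
(* The lower crossing becomes a bump. This matters only if [q < b], when it exchanges the labels
   entering the remaining columns, where [phi] is 0. *)
rewrite !two_rows_cons !inE !eqxx lT hT orbT /col_pass /=.
rewrite sub0n addn0; apply: same_or_swap_cons.
have [leqb|ltqb] : b <= q \/ q < b by lia.
  by rewrite (maxn_idPl leqb) (minn_idPr leqb); left.
rewrite (maxn_idPr (ltnW ltqb)) (minn_idPl (ltnW ltqb)).
apply: two_rows_swap_entry => //; apply/eqP; rewrite -leqn0; exact: cmp.
Qed.

(** The invariant of [two_rows_f] carried to the right edge: by hypothesis no e_i-bracket is left
    unmatched there. *)
Lemma two_rows_head m (S : m.-tuple {set 'I_n}) p q bs e0 :
  size bs = m -> (e0 = 0 -> q <= p) -> Ep S + (e0 - Ph S) = 0 ->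
  (two_rows p q S bs).2 <= (two_rows p q S bs).1.2.
Proof.
have [_ epsS phiS] := regular_set i.
elim: m S p q bs e0 => [|m IH] S p q bs e0.
  rewrite (tuple0 S) /Ep /Ph eps_tuple0 phi_tuple0; case: bs => //= _ h e.
  by apply: h; lia.
case/tupleP: S => T R; case: bs => // b bs [szb] hpq.
rewrite /Ep /Ph eps_cons phi_cons !epsS !phiS => e.
rewrite [tval _]/= two_rows_cons; set c := col_pass _ _ _ _ _.
rewrite -/((two_rows c.1.2 c.2 R bs).2) -/((two_rows c.1.2 c.2 R bs).1.2).
set a := (if high i \in T then _ else _) in e.
apply: (IH _ _ _ _ (a + (e0 - (if low i \in T then (high i \notin T).+1 else 0))))
  => //; last first.
  rewrite /Ph /Ep; move: e; move: (phi _ i R) (eps _ i R) => P Q; clearbody a.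
  by clear; lia.
rewrite /c /col_pass /a; case: (high i \in T) => //.
case: (low i \in T) => /=; first by lia.
by rewrite add0n subn0 => /hpq; lia.
Qed.

End TwoRows.

(** * Labels modulo S_n *)

Section Trim.

Variables m n : nat.

(* Left multiplication by S_n only permutes the labels below n, so they are all
   identified with 0. *)
Definition trim (x : nat) : nat := if x < n then 0 else x.

Lemma trim_lt x : x < n -> trim x = 0.
Proof. by rewrite /trim => ->. Qed.

Lemma trim_max a b : trim (maxn a b) = maxn (trim a) (trim b).
Proof. by rewrite /trim; do !case: ifP; lia. Qed.

Lemma trim_min a b : trim (minn a b) = minn (trim a) (trim b).
Proof. by rewrite /trim; do !case: ifP; lia. Qed.

Lemma trim_ltW a b : trim a < trim b -> a < b.
Proof. by rewrite /trim; do !case: ifP; lia. Qed.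

(** [trim] is weakly increasing, so it commutes with the maxima and minima taken at crossings. *)
Lemma row_pass_trim a bumps bs :
  row_pass (trim a) (zip bumps (map trim bs)) =
  (map trim (row_pass a (zip bumps bs)).1, trim (row_pass a (zip bumps bs)).2).
Proof.
elim: bumps a bs => [|bump bumps IH] a [|b bs] //=.
by case: bump; rewrite -?trim_max -?trim_min IH; case: (row_pass _ _).
Qed.

Definition tiles (D : RPD m n) (r : 'I_n) : seq bool :=
  [seq D r j | j <- enum 'I_m].

Definition trim_state (st : seq nat * seq nat) := (map trim st.1, map trim st.2).

(** Row indices are below [n], so after trimming every row is entered by the label 0. *)
Lemma trim_grid_step (D : RPD m n) (r : 'I_n) st :
  trim_state (grid_step D r st) =
  let x := row_pass 0 (zip (tiles D r) (map trim st.1)) in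
  (x.1, x.2 :: map trim st.2).
Proof.
rewrite -(trim_lt (ltn_ord r)) row_pass_trim /grid_step /trim_state /tiles.
by case: (row_pass _ _).
Qed.

Lemma size_grid_step (D : RPD m n) (r : 'I_n) st : size st.1 = m ->
  size (grid_step D r st).1 = m.
Proof.
move=> sz; have [_] := row_pass_perm r (zip [seq D r j | j <- enum 'I_m] st.1).
rewrite size_zip size_map size_enum_ord sz minnn /grid_step.
by case: (row_pass _ _).
Qed.

Lemma size_grid (D : RPD m n) (rs : seq 'I_n) st : size st.1 = m ->
  size (foldr (grid_step D) st rs).1 = m.
Proof. by move=> sz; elim: rs => //= r rs; apply: size_grid_step. Qed.

(** Upper rows see the lower ones only through the labels on their top edges; right labels emitted
    earlier are merely carried along. *)
Lemma grid_upper (D D' : RPD m n) (rs : seq 'I_n) st st' :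
  {in rs, forall r, tiles D r = tiles D' r} ->
  map trim st.1 = map trim st'.1 ->
  let F := trim_state (foldr (grid_step D) st rs) in
  let F' := trim_state (foldr (grid_step D') st' rs) in
  F.1 = F'.1 /\ exists pre,
    [/\ size pre = size rs, F.2 = pre ++ map trim st.2 &
        F'.2 = pre ++ map trim st'.2].
Proof.
elim: rs => [|r rs IH] eqt eqst; first by split=> //; exists [::].
have [|] := IH _ eqst.
  by move=> x xr; apply: eqt; rewrite inE xr orbT.
move=> /= h [pre [sz h1 h2]].
have hr := eqt r (mem_head _ _).
have [-> ->] := trim_grid_step D r (foldr (grid_step D) st rs).
have [-> ->] := trim_grid_step D' r (foldr (grid_step D') st' rs).
rewrite h hr; split=> //.
set x := row_pass _ _; exists (x.2 :: pre).
by rewrite /= sz h1 h2.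
Qed.

Lemma tilesE (D : RPD m n) r :
  tiles D r = [seq r \in T | T : {set 'I_n} <- RPD_columns D].
Proof.
pose cols := [seq [set x | D x j] | j <- enum 'I_m].
rewrite /tiles -[RHS]/[seq r \in T | T : {set 'I_n} <- cols] -[RHS]map_comp.
by apply: eq_map => j /=; rewrite inE.
Qed.

Lemma grid_two_rows (D : RPD m n) (i : 'I_n.-1) st :
  trim_state (grid_step D (low i) (grid_step D (high i) st)) =
  let x := two_rows i 0 0 (RPD_columns D) (map trim st.1) in
  (x.1.1, [:: x.1.2, x.2 & map trim st.2]).
Proof.
have h := trim_grid_step D (high i) st.
rewrite trim_grid_step; rewrite /trim_state /= in h; case: h => -> ->.
by rewrite /two_rows !tilesE.
Qed.

Lemma enum_low_high (i : 'I_n.-1) : exists s1 s2,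
  [/\ enum 'I_n = s1 ++ low i :: high i :: s2, size s1 = i,
      low i \notin s1 ++ s2 & high i \notin s1 ++ s2].
Proof.
have lt2 : i.+1 < n := ltn_ord (high i).
have lt1 : i < n := ltn_ord (low i).
exists (take i (enum 'I_n)), (drop i.+2 (enum 'I_n)).
have E : enum 'I_n = take i (enum 'I_n) ++ [:: low i, high i & drop i.+2 (enum 'I_n)].
  rewrite -{1}(cat_take_drop i (enum 'I_n)) (drop_nth (low i)) ?size_enum_ord //.
  rewrite (drop_nth (low i)) ?size_enum_ord //; congr (_ ++ [:: _, _ & _]).
    by apply: val_inj; rewrite /= nth_enum_ord.
  by apply: val_inj; rewrite /= nth_enum_ord.
have := enum_uniq 'I_n; rewrite {1}E cat_uniq /= !inE !negb_or.
case/and5P=> _ /and3P[l1 h1 _] /andP[_ l2] h2 _.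
split=> //; first by rewrite size_take size_enum_ord lt1.
  by rewrite mem_cat negb_or l1.
by rewrite mem_cat negb_or h1.
Qed.

(** [A] collects the top edges and the right edges above row i, [B] the right edges below row i+1,
    and [bs] the labels entering row i+1 from below. The rows below are common to both arrays, so
    [B] and [bs] are shared. *)
Lemma oneline_two_rows (D D' : RPD m n) (i : 'I_n.-1) :
  (forall r, r != low i -> r != high i -> tiles D r = tiles D' r) ->
  exists A A' B bs,
  let x := two_rows i 0 0 (RPD_columns D) bs in
  let x' := two_rows i 0 0 (RPD_columns D') bs in
  [/\ size A = m + i /\ size A' = m + i, size bs = m,
      map trim (oneline D) = A ++ [:: x.1.2, x.2 & B],
      map trim (oneline D') = A' ++ [:: x'.1.2, x'.2 & B] &
      x.1.1 = x'.1.1 -> A = A'].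
Proof.
move=> eqt; have [s1 [s2 [E szs1 ls hs]]] := enum_low_high i.
have eqt1 r : r \in s1 ++ s2 -> tiles D r = tiles D' r.
  move=> rs; apply: eqt; first by apply: contraNneq ls => <-.
  by apply: contraNneq hs => <-.
pose st := foldr (grid_step D) (iota n m, [::]) s2.
have E2 : foldr (grid_step D') (iota n m, [::]) s2 = st.
  rewrite /st; elim: (s2) eqt1 => //= r s IH h; rewrite IH; last first.
    by move=> x; rewrite mem_cat => xs; apply: h; rewrite mem_cat inE orbCA xs orbT.
  rewrite /grid_step; have := h r; rewrite mem_cat inE eqxx orbT /tiles => -> //.
have szst : size st.1 = m by apply: size_grid; rewrite size_iota.
pose st1 := grid_step D (low i) (grid_step D (high i) st).
pose st1' := grid_step D' (low i) (grid_step D' (high i) st).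
pose F := foldr (grid_step D) st1 s1; pose F' := foldr (grid_step D') st1' s1.
have oE : oneline D = F.1 ++ F.2.
  by rewrite /oneline E foldr_cat /= -/st -/st1 -/F; case: (F).
have oE' : oneline D' = F'.1 ++ F'.2.
  by rewrite /oneline E foldr_cat /= E2 -/st1' -/F'; case: (F').
have szF : size F.1 = m by apply: size_grid; rewrite !size_grid_step.
have szF' : size F'.1 = m by apply: size_grid; rewrite !size_grid_step.
have tst1 := grid_two_rows D i st; have tst1' := grid_two_rows D' i st.
rewrite -/st1 /trim_state in tst1; rewrite -/st1' /trim_state in tst1'.
case: tst1 => t1 t2; case: tst1' => t1' t2'.
(* Comparing an array with itself splits off the right labels of the rows [s1]. *)
have [_ [pre [szp _ F2]]] := @grid_upper D D s1 st1 st1 (fun _ _ => erefl) erefl.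
have [_ [pre' [szp' _ F2']]] := @grid_upper D' D' s1 st1' st1' (fun _ _ => erefl) erefl.
rewrite -/F /= in F2; rewrite -/F' /= in F2'.
exists (map trim F.1 ++ pre), (map trim F'.1 ++ pre'), (map trim st.2), (map trim st.1).
split.
- by rewrite !size_cat !size_map szF szF' szp szp' szs1.
- by rewrite size_map.
- by rewrite oE map_cat F2 t2 -catA.
- by rewrite oE' map_cat F2' t2' -catA.
move=> xx; have {}xx : map trim st1.1 = map trim st1'.1 by rewrite t1 t1'.
have eqs1 : {in s1, forall r, tiles D r = tiles D' r}.
  by move=> r rs; apply: eqt1; rewrite mem_cat rs.
have [/= -> [pre2 [sz2 h h']]] := grid_upper eqs1 xx; congr (_ ++ _).
have e1 : pre = pre2.
  by move: h; rewrite /= -/F F2 => /eqP; rewrite eqseq_cat ?szp ?sz2 // => /andP[/eqP].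
have e2 : pre' = pre2.
  by move: h'; rewrite /= -/F' F2' => /eqP; rewrite eqseq_cat ?szp' ?sz2 // => /andP[/eqP].
by rewrite e1 e2.
Qed.

Lemma trim_sigma (D : RPD m n) k :
  trim (sigma D k) = nth 0 (map trim (oneline D)) k.
Proof.
rewrite permE /= (nth_map 0) //.
by rewrite (perm_size (oneline_perm D)) size_iota.
Qed.

Lemma nth_two (A : seq nat) p q B (i : 'I_n.-1) (k : 'I_(m + n)) :
  size A = m + i ->
  nth 0 (A ++ [:: p, q & B]) k =
  if k == rshift m (low i) then p
  else if k == rshift m (high i) then q
  else if k < m + i then nth 0 A k else nth 0 B (k - (m + i.+2)).
Proof.
move=> sz; rewrite nth_cat sz -!val_eqE /=.
case: ltngtP => h; first by rewrite ifF //; lia.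
  case: eqP => [->|h']; first by rewrite addnS subSnn.
  by have -> : k - (m + i) = (k - (m + i.+2)).+2 by lia.
by rewrite h subnn.
Qed.

Lemma tuple_f_other (i : 'I_n.-1) m' (S S' : m'.-tuple {set 'I_n}) r :
  r != low i -> r != high i -> f_op (tuple_crystal n m') i S = Some S' ->
  [seq r \in T | T : {set 'I_n} <- S] = [seq r \in T | T : {set 'I_n} <- S'].
Proof.
move=> rl rh; elim: m' S S' => [|k IH] S S' //.
case/tupleP: S => T R; rewrite f_cons; case: ifP => _.
  by case E: (f_op _ _ _) => [R'|] //= [<-]; rewrite /= (IH _ _ E).
rewrite set_fE; case: ifP => //= _ [<-] /=; congr (_ :: _).
by case: ifP => _; rewrite !inE ?rl ?(negPf rh).
Qed.

Lemma f_op_RPD_columns (i : 'I_n.-1) (D D' : RPD m n) :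
  f_op (RPD_crystal n m) i D = Some D' ->
  f_op (tuple_crystal n m) i (RPD_columns D) = Some (RPD_columns D').
Proof.
by rewrite /=; case E: (f_op _ _ _) => [S|] //= [<-]; rewrite RPD_of_columnsK.
Qed.

Lemma shift_simple (i : 'I_n.-1) (k : 'I_(m + n)) :
  shift_perm m (simple_refl i) k =
  tperm (rshift m (low i)) (rshift m (high i)) k.
Proof.
case: (split_ordP k) => j ->.
  by rewrite shift_permL tpermD // eq_rlshift.
by rewrite shift_permR -inj_tperm //; apply: rshift_inj.
Qed.

(** The labels leaving rows i and i+1 are the values of sigma_D at [rshift m (low i)] and
    [rshift m (high i)], so exchanging them is right multiplication by 1^m x s_i. *)
Lemma sigma_f (D D' : RPD m n) (i : 'I_n.-1) :
  f_op (RPD_crystal n m) i D = Some D' ->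
  (forall k, trim (sigma D' k) = trim (sigma D k)) \/
  [/\ eps (RPD_crystal n m) i D = 0,
      trim (sigma D (rshift m (high i))) < trim (sigma D (rshift m (low i))) &
      forall k, trim (sigma D' k) =
                trim (sigma D (shift_perm m (simple_refl i) k))].
Proof.
move=> fD; have fS := f_op_RPD_columns fD.
have [|A [A' [B [bs [[szA szA'] szb oD oD' AA']]]]] := @oneline_two_rows D D' i.
  by move=> r rl rh; rewrite !tilesE (tuple_f_other rl rh fS).
have [_ epsE phiE] := regular_RPD m i.
have [_ fSome _ _] := regular_tuple m i.
have phi0 : 0 < phi (tuple_crystal n m) i (RPD_columns D).
  by have [_ -> _] := fSome _ _ fS.
(* Both entering labels are trimmed to 0, so the invariant holds initially with [e0 = 0]. *)
have := two_rows_f szb (fun=> leqnn 0) phi0 fS.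
rewrite -epsE; move: oD oD' AA'; cbv zeta.
set x := two_rows _ _ _ _ _; set x' := two_rows _ _ _ _ _ => oD oD' AA'.
case=> [xx|[eps0 lt xx]].
  by left=> k; rewrite !trim_sigma oD oD' xx AA' ?xx.
have lh : rshift m (high i) != rshift m (low i).
  by rewrite eq_rshift eq_sym low_neq_high.
rewrite xx in AA' oD'; rewrite -AA' // in oD' szA'.
right; split=> //.
  by rewrite !trim_sigma oD !(@nth_two _ _ _ _ i) // !eqxx (negPf lh).
move=> k; rewrite shift_simple !trim_sigma oD oD' !(@nth_two _ _ _ _ i) //.
case: tpermP => [->|->|/eqP/negPf -> /eqP/negPf -> //].
  by rewrite !eqxx (negPf lh).
by rewrite !eqxx (negPf lh).
Qed.

Lemma sigma_head (D : RPD m n) (i : 'I_n.-1) :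
  eps (RPD_crystal n m) i D = 0 ->
  trim (sigma D (rshift m (high i))) <= trim (sigma D (rshift m (low i))).
Proof.
have [_ -> _] := regular_RPD m i => eps0.
have [//|A [_ [B [bs [[szA _] szb oD _ _]]]]] := @oneline_two_rows D D i.
have := @two_rows_head n i m (RPD_columns D) 0 0 bs 0 szb (fun=> leqnn 0).
rewrite eps0 sub0n => /(_ erefl) le.
rewrite !trim_sigma oD !(@nth_two _ _ _ _ i) // !eqxx ifF //.
by rewrite eq_rshift eq_sym; apply/negbTE/low_neq_high.
Qed.

End Trim.

(** * Right factors *)

Section DoubleCosets.

Variables m n : nat.

Lemma incl_permM (u v : 'S_n) :
  incl_perm m (perm_comp u v) = perm_comp (incl_perm m u) (incl_perm m v).
Proof.
apply/permP => k; rewrite perm_compE; have [le_nk|lt_kn] := leqP n k.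
  by rewrite !incl_perm_id.
have -> : k = incl_ord m (Ordinal lt_kn) by apply: val_inj.
by rewrite !incl_permE perm_compE.
Qed.

Lemma shift_permM (u v : 'S_n) :
  shift_perm m (perm_comp u v) = perm_comp (shift_perm m u) (shift_perm m v).
Proof.
apply/permP => k; rewrite perm_compE; case: (split_ordP k) => j ->.
  by rewrite !shift_permL.
by rewrite !shift_permR perm_compE.
Qed.

Lemma shift_perm1 : shift_perm m (1%g : 'S_n) = 1%g.
Proof.
apply/permP => k; rewrite perm1; case: (split_ordP k) => j ->.
  by rewrite shift_permL.
by rewrite shift_permR perm1.
Qed.

Lemma trim_incl_perm (u : 'S_n) (k : 'I_(m + n)) :
  trim n (incl_perm m u k) = trim n k.
Proof.
have [le_nk|lt_kn] := leqP n k; first by rewrite incl_perm_id.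
have -> : k = incl_ord m (Ordinal lt_kn) by apply: val_inj.
by rewrite incl_permE !trim_lt //=.
Qed.

(** The quotient of [s'] by [s] preserves trimmed labels: it fixes those at least [n], hence
    permutes the others. *)
Lemma trim_eq_incl (s s' : 'S_(m + n)) :
  (forall k, trim n (s' k) = trim n (s k)) ->
  exists u : 'S_n, s' = perm_comp (incl_perm m u) s.
Proof.
move=> eqt; pose g := perm_comp s' s^-1%g.
have gt k : trim n (g k) = trim n k by rewrite /g perm_compE eqt permKV.
have g_big (k : 'I_(m + n)) : n <= k -> g k = k.
  move=> le; apply: val_inj; move: (gt k); rewrite /trim [k < n]ltnNge le /=.
  by case: ifP => //; lia.
have g_small (k : 'I_n) : g (incl_ord m k) < n.
  rewrite ltnNge; apply/negP => le; move/g_big/perm_inj: (le) => e.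
  by rewrite e leqNgt /= ltn_ord in le.
have ginj : injective (fun k => Ordinal (g_small k)).
  move=> k l /(congr1 val) /= /val_inj /perm_inj /(congr1 val) /=.
  exact: val_inj.
exists (perm ginj); apply: (mulgI s^-1%g).
rewrite /perm_comp mulgA mulVg mul1g -/(perm_comp s' s^-1%g) -/g.
apply/permP => k; have [le_nk|lt_kn] := leqP n k.
  by rewrite incl_perm_id // g_big.
have -> : k = incl_ord m (Ordinal lt_kn) by apply: val_inj.
by rewrite incl_permE [perm ginj _]permE; apply: val_inj.
Qed.

(** By [trim_eq_incl], this puts sigma_D' in the set S_n sigma_D (1^m x [x]). *)
Definition rel_shift (D D' : RPD m n) (x : 'S_n) :=
  forall k, trim n (sigma D' k) = trim n (sigma D (shift_perm m x k)).

Lemma rel_shift_coset (D D' : RPD m n) x : rel_shift D D' x ->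
  exists u : 'S_n, sigma D' =
    perm_comp (incl_perm m u) (perm_comp (sigma D) (shift_perm m x)).
Proof. by move=> h; apply: trim_eq_incl => k; rewrite perm_compE h. Qed.

Lemma rel_shift_sym (D D' : RPD m n) x :
  rel_shift D D' x -> rel_shift D' D x^-1%g.
Proof.
move=> h k; rewrite h -perm_compE -shift_permM /perm_comp mulVg shift_perm1.
by rewrite perm1.
Qed.

Lemma is_sigma_bar_shift (D D' : RPD m n) x s : rel_shift D D' x ->
  is_sigma_bar D' s -> is_sigma_bar D s.
Proof.
move=> /rel_shift_coset[u0 E]; rewrite /is_sigma_bar => /and3P[+ -> ->].
rewrite !andbT => /existsP[u /existsP[v /eqP ->]].
apply/existsP; exists (perm_comp u u0); apply/existsP.
exists (perm_comp v x^-1%g).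
have -> : (perm_comp v x^-1)%g^-1%g = perm_comp x v^-1%g.
  by rewrite /perm_comp invMg invgK.
by rewrite incl_permM shift_permM E /perm_comp !mulgA.
Qed.

(** The double cosets agree, hence so do the defining predicates, and [xchoose] depends only on the
    predicate. *)
Lemma sigma_bar_shift (D D' : RPD m n) x : rel_shift D D' x ->
  sigma_bar D' = sigma_bar D.
Proof.
move=> h; apply: eq_xchoose => s; apply/idP/idP.
  exact: is_sigma_bar_shift h.
exact: is_sigma_bar_shift (rel_shift_sym h).
Qed.

Definition right_factor (D : RPD m n) (v : 'S_n) : Prop :=
  exists u : 'S_n, sigma D =
    perm_comp (incl_perm m u) (perm_comp (sigma_bar D) (shift_perm m v)).

Lemma right_factor_shift (D D' : RPD m n) x v : rel_shift D D' x ->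
  right_factor D v -> right_factor D' (perm_comp v x).
Proof.
move=> h [u E]; have [u0 E0] := rel_shift_coset h; exists (perm_comp u0 u).
by rewrite (sigma_bar_shift h) incl_permM shift_permM E0 E /perm_comp !mulgA.
Qed.

(** [sigma_bar D] is decreasing on the last [n] positions, so its values compare in the reverse
    order of [v a] and [v b]; the left factor from S_n disappears under [trim]. *)
Lemma right_factor_trim_lt (D : RPD m n) v (a b : 'I_n) : right_factor D v ->
  trim n (sigma D (rshift m b)) < trim n (sigma D (rshift m a)) -> v a < v b.
Proof.
case=> u ->; rewrite !perm_compE !shift_permR !trim_incl_perm => /trim_ltW lt.
have /and3P[_ _ /forallP dec] := xchooseP (sigma_bar_exists D).
rewrite ltnNge leq_eqVlt; apply/negP => /orP[/eqP/val_inj e|ltba].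
  by rewrite e ltnn in lt.
move/(_ (v b))/forallP/(_ (v a))/implyP/(_ ltba): dec.
by rewrite -/(sigma_bar D); lia.
Qed.

Lemma sub_wP (C : {set RPD m n}) w c :
  reflect (c \in C /\ exists2 v, right_factor c v & bruhat v w) (c \in sub_w C w).
Proof.
rewrite inE; apply: (iffP andP) => -[cC].
  case/existsP=> u /existsP[v /andP[/eqP E le]].
  by split=> //; exists v => //; exists u.
case=> v [u E] le; split=> //; apply/existsP; exists u; apply/existsP; exists v.
by rewrite -E eqxx.
Qed.

End DoubleCosets.

(** * The sets C_w along an i-string *)

Section Strings.

Variables (m n : nat) (i : 'I_n.-1).
Let s := simple_refl i.
Let X := RPD_crystal n m.

Lemma right_factor_f (D D' : RPD m n) : f_op X i D = Some D' ->
  (forall v, right_factor D v <-> right_factor D' v) \/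
  [/\ eps X i D = 0,
      forall v, right_factor D v -> v (low i) < v (high i) &
      forall v, right_factor D v <-> right_factor D' (perm_comp v s)].
Proof.
case/sigma_f => [eqt|[eps0 lt eqt]].
  have h : rel_shift D D' 1%g by move=> k; rewrite shift_perm1 perm1.
  have h' := rel_shift_sym h; rewrite invg1 in h'.
  left=> v; have e : perm_comp v 1%g = v by rewrite /perm_comp mul1g.
  by split; rewrite -{2}e; apply: right_factor_shift.
right; split=> // [v rf|v]; first exact: right_factor_trim_lt lt.
have h : rel_shift D D' s by [].
have h' := rel_shift_sym h; rewrite tpermV in h'.
split; first exact: right_factor_shift.
by rewrite -{2}(simple_reflK i v); apply: right_factor_shift.
Qed.

(** The labels leaving rows i and i+1 are either strictly ordered, or equal after trimming; in the
    latter case s_i can be absorbed on the left by S_n. *)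
Lemma right_factor_head (D : RPD m n) : eps X i D = 0 ->
  (forall v, right_factor D v -> v (low i) < v (high i)) \/
  (forall v, right_factor D v -> right_factor D (perm_comp v s)).
Proof.
move/sigma_head; rewrite leq_eqVlt => /orP[/eqP e|lt]; last first.
  by left=> v rf; apply: right_factor_trim_lt lt.
right=> v; apply: right_factor_shift => k; rewrite shift_simple.
by case: tpermP => [->|->|].
Qed.

Lemma union_closed (C : {set RPD m n}) : union_of_full_subcrystals C ->
  forall D D', f_op X i D = Some D' -> (D \in C) = (D' \in C).
Proof.
case=> P full -> D D' fD.
have edge : crystal_edge D D' by apply/existsP; exists i; apply/eqP.
suff h x y : relU (@crystal_edge n m) (fun x y => crystal_edge y x) x y ->
    x \in cover P -> y \in cover P.
  by apply/idP/idP; apply: h; rewrite /= edge ?orbT.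
move=> xy /bigcupP[F FP xF]; apply/bigcupP; exists F => //.
have [D0 FE] := full _ FP; move: xF; rewrite FE !inE => h.
apply: (connect_trans h); exact: connect1.
Qed.

Variables (C : {set RPD m n}) (w : 'S_n).
Hypothesis hC : union_of_full_subcrystals C.
Hypothesis hw : w (low i) < w (high i).

(** Right factors change at most by [s], and the Bruhat interval below [w s] is stable under [s]. *)
Lemma sub_w_asc_f D D' : f_op X i D = Some D' ->
  (D \in sub_w C (perm_comp w s)) = (D' \in sub_w C (perm_comp w s)).
Proof.
move=> fD; have CD := union_closed hC fD.
case: (right_factor_f fD) => [rf|[_ _ rf]].
  by apply/sub_wP/sub_wP; rewrite CD => -[-> [v /rf h le]]; split=> //; exists v.
apply/sub_wP/sub_wP; rewrite CD => -[-> [v h le]]; split=> //;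
  exists (perm_comp v s); rewrite ?bruhat_ascent_stable //; apply/rf => //.
by rewrite simple_reflK.
Qed.

Lemma sub_w_sub : sub_w C w \subset sub_w C (perm_comp w s).
Proof.
apply/subsetP => c /sub_wP[cC [v rf le]]; apply/sub_wP; split=> //.
by exists v => //; apply: connect_trans le (bruhat_simple hw).
Qed.

(** Passing from [D'] to [D] multiplies a right factor by [s] only when this lowers it in Bruhat
    order. *)
Lemma sub_w_e D D' : f_op X i D = Some D' ->
  D' \in sub_w C w -> D \in sub_w C w.
Proof.
move=> fD /sub_wP[]; rewrite -(union_closed hC fD) => cD [v h le].
apply/sub_wP; split=> //; case: (right_factor_f fD) => [rf|[_ asc rf]].
  by exists v => //; apply/rf.
have h' : right_factor D (perm_comp v s) by apply/rf; rewrite simple_reflK.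
exists (perm_comp v s) => //; apply: connect_trans le.
by rewrite -{2}(simple_reflK i v); apply/bruhat_simple/asc.
Qed.

Lemma sub_w_f D D' : f_op X i D = Some D' -> 0 < eps X i D ->
  D \in sub_w C w -> D' \in sub_w C w.
Proof.
move=> fD; case: (right_factor_f fD) => [rf _|[-> //]].
case/sub_wP; rewrite (union_closed hC fD) => cD [v h le].
by apply/sub_wP; split=> //; exists v => //; apply/rf.
Qed.

(** A right factor [v] below [w s] has [v] or [v s] below [w]. In the second case either [v] has an
    ascent at i and lies below [v s], or [v s] is a right factor as well. *)
Lemma sub_w_head D : eps X i D = 0 ->
  D \in sub_w C (perm_comp w s) -> D \in sub_w C w.
Proof.
move=> eps0 /sub_wP[cD [v h le]]; apply/sub_wP; split=> //.
case: (bruhat_ascent_min le) => le'; first by exists v.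
case: (right_factor_head eps0) => [asc|rf]; last first.
  by exists (perm_comp v s) => //; apply: rf.
by exists v => //; apply: connect_trans le'; apply/bruhat_simple/asc.
Qed.

End Strings.

(** * Weights and characters of strings *)

Section Weights.

Variables (n : nat) (i : 'I_n.-1).

Lemma wt_set (T : {set 'I_n}) j : wt (set_crystal n) T j = (j \in T).
Proof.
rewrite /= mnm_sumE (eq_bigr (fun k => (k == j : nat))) => [|k _]; last first.
  by rewrite mnm1E.
case jT : (j \in T).
  by rewrite (bigD1 j) //= eqxx big1 // => k /andP[_ /negPf ->].
by rewrite big1 // => k kT; case: eqP => // e; rewrite -e kT in jT.
Qed.

Lemma wt_cons m T (R : m.-tuple {set 'I_n}) :
  wt (tuple_crystal n m.+1) (cons_tuple T R) =
  (wt (set_crystal n) T + wt (tuple_crystal n m) R)%MM.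
Proof. by rewrite /= behead_cons theadE. Qed.

(** The identity phi - eps = 2 (wt_i - wt_(i+1)), written without subtraction. In particular [phi]
    and [eps] have the same parity. *)
Lemma wt_balance m (S : m.-tuple {set 'I_n}) :
  phi (tuple_crystal n m) i S + (wt (tuple_crystal n m) S (high i)).*2 =
  eps (tuple_crystal n m) i S + (wt (tuple_crystal n m) S (low i)).*2.
Proof.
have [_ epsS phiS] := regular_set i.
elim: m S => [|m IH] S; first by rewrite phi_tuple0 eps_tuple0 /= !mnm0E.
case/tupleP: S => T R; rewrite phi_cons eps_cons wt_cons !mnmDE !wt_set epsS phiS.
move: (IH R); move: (phi _ _ R) (eps _ _ R) (wt _ R _) (wt _ R _) => a b c d.
by case: (low i \in T) (high i \in T) => [] [] /=; lia.
Qed.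

Lemma wt_set_f (T T' : {set 'I_n}) : set_f i T = Some T' ->
  if high i \in T then wt (set_crystal n) T = (wt (set_crystal n) T' + U_(low i))%MM
  else wt (set_crystal n) T' = (wt (set_crystal n) T + U_(high i))%MM.
Proof.
rewrite set_fE; case: ifP => // lT [<-]; case: ifP => hT; apply/mnmP => j;
  rewrite mnmDE !wt_set mnm1E hT !inE.
  by rewrite (eq_sym _ j); case: eqP => [->|]; rewrite ?lT ?addn0.
by rewrite (eq_sym _ j); case: eqP => [->|]; rewrite ?hT ?addn0.
Qed.

(** Where f_i acts on a column [T] followed by [R], [wt_balance] for [R] shows that [eps] of the
    tuple has the parity of [eps] of [T]: odd if [T] contains i and i+1, and i is removed; even if
    it contains i alone, and i+1 is added. Columns passed over on the left do not change [eps]. *)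
Lemma wt_f m (S S' : m.-tuple {set 'I_n}) : 
  f_op (tuple_crystal n m) i S = Some S' ->
  if odd (eps (tuple_crystal n m) i S)
  then wt (tuple_crystal n m) S = (wt (tuple_crystal n m) S' + U_(low i))%MM
  else wt (tuple_crystal n m) S' = (wt (tuple_crystal n m) S + U_(high i))%MM.
Proof.
have [_ epsS phiS] := regular_set i.
elim: m S S' => [|m IH] S S' //; case/tupleP: S => T R.
rewrite f_cons eps_cons; case: ltnP => cmp.
  case E: (f_op _ _ _) => [R'|] //; rewrite [omap _ _]/= => -[<-]; have := IH _ _ E.
  rewrite (eqP (ltnW cmp : eps _ _ _ - _ == 0)) addn0 !wt_cons.
  by case: ifP => _ ->; rewrite addmA.
case E: (set_f i T) => [T'|] //; rewrite [omap _ _]/= => -[<-]; rewrite !wt_cons.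
have := wt_set_f E; move: E cmp; rewrite epsS set_fE; case: (low i \in T) => // _.
have := wt_balance R; move: (phi _ _ R) (eps _ _ R) (wt _ R _) (wt _ R _).
move=> a b c d bal; case: (high i \in T) => /= cmp -> /=.
  have -> : odd (b + (1 - a)) by lia.
  by rewrite -!addmA; congr (_ + _)%MM; rewrite addmC.
have -> : odd (b + (0 - a)) = false by lia.
by rewrite -!addmA; congr (_ + _)%MM; rewrite addmC.
Qed.

End Weights.

(** * Decomposition of sums into i-strings *)

Section RegularStrings.

Variables (n : nat) (B : finType) (X : crystal n B) (i : 'I_n.-1).
Hypothesis reg : regular X i.

Definition f_rel : rel B := fun b c => f_op X i b == Some c.

Definition string_head (b : B) : B := odflt b (op_iter (e_op X i) (eps X i b) b).

Lemma f_rel_eps b c : f_rel b c -> eps X i c = (eps X i b).+1.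
Proof. by case: reg => _ fS _ _ /eqP /fS[]. Qed.

Lemma op_iterSr (g : B -> option B) k b b' : g b = Some b' ->
  op_iter g k.+1 b = op_iter g k b'.
Proof. by move=> E; rewrite /op_iter iterSr /= E. Qed.

Lemma op_iter_f_rel k b c : op_iter (e_op X i) k c = Some b -> connect f_rel b c.
Proof.
case: reg => _ _ _ eS; elim: k b => [|k IH] b; first by case=> ->.
rewrite op_iterS; case E: (op_iter _ _ _) => [b'|] //= eb.
by apply: connect_trans (IH _ E); apply/connect1/eqP/eS.
Qed.

Lemma string_headP b : eps X i (string_head b) = 0 /\
  op_iter (e_op X i) (eps X i b) b = Some (string_head b).
Proof.
case: reg => _ fS eN eS.
have [||b' E e] := @op_iter_level _ (e_op X i) (eps X i) _ _ (eps X i b) b (leqnn _).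
- exact: eN.
- by move=> c c' /eS /fS[].
by rewrite /string_head E; split=> //=; lia.
Qed.

Lemma string_head_connect b c : connect f_rel b c ->
  string_head c = string_head b.
Proof.
case/connectP=> p pth ->; elim: p b pth => //= a p IH b /andP[ba pth].
rewrite (IH _ pth); have [_ Ha] := string_headP a; have [_ Hb] := string_headP b.
case: reg => _ fS _ _; have [ea _ epsa] := fS _ _ (eqP ba).
by move: Ha; rewrite epsa (op_iterSr _ ea) Hb => -[].
Qed.

Lemma string_headE h c : eps X i h = 0 -> (string_head c == h) = connect f_rel h c.
Proof.
move=> h0; apply/eqP/idP => [<-|/string_head_connect ->].
  by have [_ /op_iter_f_rel] := string_headP c.
by rewrite /string_head h0.
Qed.

Lemma connect_f_relE b c : connect f_rel b c =
  (c == b) || (if f_op X i b is Some b' then connect f_rel b' c else false).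
Proof.
apply/idP/orP => [/connectP[[|a p] /=]|[/eqP -> //|]].
- by move=> _ ->; left.
- case/andP=> /eqP -> pth ->; right; apply/connectP; by exists p.
case E: (f_op X i b) => [b'|] //; apply: connect_trans.
by apply/connect1/eqP.
Qed.

Lemma connect_f_rel_eps b c : connect f_rel b c -> eps X i b <= eps X i c.
Proof.
case/connectP=> p pth ->; elim: p b pth => //= a p IH b /andP[ba /IH].
by rewrite (f_rel_eps ba); apply: ltnW.
Qed.

Lemma f_relN b b' : f_op X i b = Some b' -> connect f_rel b' b = false.
Proof.
move=> fb; apply/negP => /connect_f_rel_eps.
have /f_rel_eps -> : f_rel b b' by apply/eqP.
by rewrite ltnn.
Qed.

Lemma connect_f_rel_closed (P : {set B}) :
  (forall b b', f_op X i b = Some b' -> b \in P -> b' \in P) ->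
  forall b c, connect f_rel b c -> b \in P -> c \in P.
Proof.
move=> cl b c /connectP[p pth ->]; elim: p b pth => //= a p IH b /andP[/eqP ba pth].
by move=> bP; apply: IH => //; apply: cl bP.
Qed.

Lemma connect_f_rel_coclosed (P : {set B}) :
  (forall b b', f_op X i b = Some b' -> b' \in P -> b \in P) ->
  forall b c, connect f_rel b c -> c \in P -> b \in P.
Proof.
move=> cl b c /connectP[p pth ->]; elim: p b pth => //= a p IH b /andP[/eqP ba pth].
by move=> cP; apply: cl ba _; apply: IH.
Qed.

Section Sums.

Local Open Scope ring_scope.
Variables (R : nmodType) (G : B -> R).

Lemma string_sum b :
  \sum_(c | connect f_rel b c) G c =
  G b + (if f_op X i b is Some b' then \sum_(c | connect f_rel b' c) G c else 0).
Proof.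
rewrite (bigD1 b) //=; congr (_ + _).
case E: (f_op X i b) => [b'|]; last first.
  by apply: big1 => c; rewrite connect_f_relE E orbF => /andP[->].
apply: eq_bigl => c; rewrite connect_f_relE E.
by case: eqP => [->|] /=; rewrite ?andbT // f_relN.
Qed.

(** [Y] only has to contain the relevant heads, so one index set can serve for several sums. *)
Lemma sum_over_heads (Y : {set B}) (P : pred B) :
  {in P, forall c, string_head c \in Y} ->
  \sum_(c | P c) G c =
  \sum_(h in Y | eps X i h == 0)
     \sum_(c | P c && connect f_rel h c) G c.
Proof.
move=> PY; rewrite (partition_big string_head
  (fun h => (h \in Y) && (eps X i h == 0))) => [|c Pc] /=; last first.
  by rewrite PY //; have [-> _] := string_headP c.
apply: eq_bigr => h /andP[_ /eqP h0]; apply: eq_bigl => c.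
by rewrite string_headE.
Qed.

End Sums.

End RegularStrings.

(** * Characters of i-strings and pi^K_i *)

Section Characters.

Variables (m n : nat) (i : 'I_n.-1).
Local Open Scope ring_scope.

Let X := RPD_crystal n m.
Let s := simple_refl i.
Let x : {mpoly int[n]} := 'X_(low i).
Let y : {mpoly int[n]} := 'X_(high i).
Let mon (D : RPD m n) : {mpoly int[n]} := 'X_[wt X D].
Let str (D : RPD m n) : {mpoly int[n]} := \sum_(c | connect (f_rel X i) D c) mon c.

Let reg : regular X i.
Proof. by case: (regular_RPD m i). Qed.

Lemma subX_neq0 : x - y != 0.
Proof.
rewrite subr_eq0; apply: contraNneq (low_neq_high i) => /mpolyP /(_ U_(low i)%MM).
rewrite !mcoeffX eqxx; case: eqP => // /mnmP /(_ (low i)).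
by rewrite !mnm1E eqxx; case: eqP => // ->.
Qed.

Lemma msym_refl_var j : msym s 'X_j = 'X_(s j) :> {mpoly int[n]}.
Proof.
rewrite msymX; congr 'X_[_]; apply/mnmP=> k.
by rewrite mnmE !mnm1E (can2_eq (permK s) (permKV s)).
Qed.

Lemma msym_x : msym s x = y.
Proof. by rewrite msym_refl_var /s /simple_refl tpermL. Qed.

Lemma msym_y : msym s y = x.
Proof. by rewrite msym_refl_var /s /simple_refl tpermR. Qed.

Lemma msymK (p : {mpoly int[n]}) : msym s (msym s p) = p.
Proof. by rewrite -msymMm tperm2 msym1m. Qed.

(** The chosen quotient is identified by cancelling [x - y]. *)
Lemma piK_unique (f g : {mpoly int[n]}) :
  g * (x - y) = (1 + y) * x * f - msym s ((1 + y) * x * f) -> g = piK i f.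
Proof.
move=> E; apply: (mulIf subX_neq0); rewrite E.
by rewrite (eqP (xchooseP (divided_diff_exists i ((1 + y) * x * f)))).
Qed.

Lemma RPD_wt_f (D D' : RPD m n) : f_op X i D = Some D' ->
  if odd (eps X i D) then wt X D = (wt X D' + U_(low i))%MM
  else wt X D' = (wt X D + U_(high i))%MM.
Proof.
move/f_op_RPD_columns/wt_f; have [_ epsE _] := regular_RPD m i.
by rewrite -epsE.
Qed.

(** Telescoping, two steps of the string at a time: the monomial M at an even position is followed
    by y M = x N and then by N, and (x - y)(1 + y) M + (1 + y) x N = (1 + y) x M. The exponent [l]
    is the weight at the end of the string. *)
Lemma str_tail k (D : RPD m n) : ~~ odd (eps X i D) -> phi X i D = k.*2 ->
  exists2 l : 'X_{1..n},
    (l + U_(low i) *+ k = wt X D + U_(high i) *+ k)%MM &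
    (x - y) * str D = (1 + y) * x * mon D - (1 + x) * y * 'X_[l].
Proof.
have [fN fS _ _] := reg.
elim: k D => [|k IH] D ev phiD.
  exists (wt X D); first by rewrite !mulm0n.
  rewrite /str string_sum //; case E: (f_op X i D) => [D'|].
    by have [_ e _] := fS _ _ E; rewrite phiD in e.
  by rewrite addr0 -/(mon D); ring.
case E1: (f_op X i D) => [D1|]; last by move: (fN _ E1); rewrite phiD.
have [_ phi1 eps1] := fS _ _ E1.
case E2: (f_op X i D1) => [D2|]; last by move: (fN _ E2); rewrite phiD in phi1; lia.
have [_ phi2 eps2] := fS _ _ E2.
have ev2 : ~~ odd (eps X i D2) by rewrite eps2 eps1 /= negbK.
have phiD2 : phi X i D2 = k.*2 by rewrite phiD in phi1; lia.
have [l lE strE] := IH D2 ev2 phiD2.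
have w1 := RPD_wt_f E1; rewrite (negPf ev) in w1.
have w2 := RPD_wt_f E2; rewrite eps1 oddS ev in w2.
exists l.
  have w : (wt X D2 + U_(low i))%MM = (wt X D + U_(high i))%MM by rewrite -w2 -w1.
  rewrite !mulmSr !addmA lE (addmC _ (U_(low i))%MM) addmA.
  by rewrite (addmC (U_(low i))%MM) w -!addmA (addmC (U_(high i))%MM).
have m1 : mon D1 = mon D * y by rewrite /mon w1 mpolyXD.
have m2 : mon D * y = mon D2 * x by rewrite -m1 /mon w2 mpolyXD.
rewrite /str string_sum // E1 string_sum // E2 -/(str D2) !mulrDr strE m1.
have -> : (1 + y) * x * mon D2 = (1 + y) * (mon D2 * x) by ring.
by rewrite -m2; ring.
Qed.

(** At a head, [wt_balance] makes the string [2k] steps long with k = wt_i - wt_(i+1), so the end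
    weight [l] is the image of the head weight under s_i. *)
Lemma str_head (D : RPD m n) : eps X i D = 0%N ->
  str D * (x - y) = (1 + y) * x * mon D - msym s ((1 + y) * x * mon D).
Proof.
move=> eps0; have [_ epsE phiE] := regular_RPD m i.
have := wt_balance i (RPD_columns D); rewrite -epsE -phiE eps0.
rewrite -[wt (tuple_crystal n m) (RPD_columns D)]/(wt X D) => bal.
pose k := (wt X D (low i) - wt X D (high i))%N.
have phiD : phi X i D = k.*2.
  by move: bal; rewrite /k /X; move: (phi _ _ D) (wt _ D _) (wt _ D _); lia.
have [|l lE strE] := @str_tail k D _ phiD; first by rewrite eps0.
rewrite mulrC strE !msymM msymD msym1 msym_x msym_y; congr (_ - _ * _).
rewrite msymX; congr 'X_[_]; apply/mnmP => j; rewrite mnmE.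
move/mnmP/(_ j): lE; rewrite !mnmDE !mulmnE !mnm1E.
rewrite tpermV; case: tpermP => [->|->|/eqP hl /eqP hh].
- rewrite eqxx eq_sym (negPf (low_neq_high i)); rewrite /k; lia.
- rewrite eqxx (negPf (low_neq_high i)); rewrite /k; lia.
by rewrite !(eq_sym _ j) (negPf hl) (negPf hh) !mul0n !addn0.
Qed.

(** By [str_head], the product with [x - y] has the form g - s_i g, so it changes sign under s_i, as
    [x - y] does. *)
Lemma str_symmetric (D : RPD m n) : eps X i D = 0%N -> msym s (str D) = str D.
Proof.
move=> eps0; apply: (mulIf subX_neq0); have E := str_head eps0.
have := congr1 (msym s) E; rewrite msymM !msymB msymK msym_x msym_y => E'.
rewrite E; apply: oppr_inj; rewrite opprB -E'; ring.
Qed.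

End Characters.

(** * C_(w s_i) as a Demazure extension of C_w *)

Section Demazure.

Variables (m n : nat) (i : 'I_n.-1).
Let X := RPD_crystal n m.
Variables (C : {set RPD m n}) (w : 'S_n).
Hypothesis hC : union_of_full_subcrystals C.
Hypothesis hw : w (low i) < w (high i).
Let Y := sub_w C (perm_comp w (simple_refl i)).
Let Z := sub_w C w.

Let reg : regular X i.
Proof. by case: (regular_RPD m i). Qed.

Let ZY : {subset Z <= Y}.
Proof. exact/subsetP/sub_w_sub. Qed.

Lemma string_sub_w D D' : connect (f_rel X i) D D' -> (D \in Y) = (D' \in Y).
Proof.
move=> DD'; apply/idP/idP.
  by apply: connect_f_rel_closed DD' => a b /(sub_w_asc_f hC hw) ->.
by apply: connect_f_rel_coclosed DD' => a b /(sub_w_asc_f hC hw) ->.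
Qed.

Lemma string_head_sub_w D : D \in Y -> string_head X i D \in Z.
Proof.
have [h0 /(op_iter_f_rel reg) con] := string_headP reg D.
by rewrite -(string_sub_w con) => /(sub_w_head h0).
Qed.

Lemma sub_w_demazure : Y = demazure C i Z.
Proof.
apply/setP => D; apply/idP/demazureP => [DY|[CD [k [D' [E D'Z]]]]]; last first.
  by rewrite -(string_sub_w (op_iter_f_rel reg E)) ZY.
split; first by case/sub_wP: DY.
exists (eps X i D), (string_head X i D); have [_ E] := string_headP reg D.
by split=> //; apply: string_head_sub_w.
Qed.

Local Open Scope ring_scope.

(** C_w contains the head, is closed under e_i, and is closed under f_i off the head, so the
    successor of the head decides between the two cases. *)
Lemma string_sum_sub_w (R : nmodType) (G : RPD m n -> R) h :
  h \in Y -> eps X i h = 0%N ->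
  \sum_(c | (c \in Z) && connect (f_rel X i) h c) G c = G h \/
  \sum_(c | (c \in Z) && connect (f_rel X i) h c) G c =
  \sum_(c | connect (f_rel X i) h c) G c.
Proof.
move=> hY h0; have hZ := sub_w_head h0 hY.
have hE c : (c \in Z) && connect (f_rel X i) h c = (c == h) ||
    (if f_op X i h is Some h' then (c \in Z) && connect (f_rel X i) h' c else false).
  rewrite (connect_f_relE X i h); case: eqP => [->|_] /=; first by rewrite andbT.
  by case: (f_op _ _ _); rewrite ?andbF.
have single : (if f_op X i h is Some h' then h' \notin Z else true) ->
    \sum_(c | (c \in Z) && connect (f_rel X i) h c) G c = G h.
  move=> fh; rewrite (eq_bigl (pred1 h)) ?big_pred1_eq // => c; rewrite hE.
  move: fh; case E: (f_op X i h) => [h'|]; rewrite ?orbF // => nZ.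
  case con: (connect (f_rel X i) h' c); rewrite ?andbF ?orbF // andbT.
  rewrite orb_idr // => cZ; case/negP: nZ.
  by apply: (connect_f_rel_coclosed _ con cZ) => a b; apply: sub_w_e.
case E: (f_op X i h) single => [h'|] single; last by left; apply: single.
have [hZ'|nZ] := boolP (h' \in Z); last by left; apply: single.
right; apply: eq_bigl => c; rewrite hE (connect_f_relE X i h) E.
case: eqP => //= _; rewrite andb_idl // => con.
(* [sub_w_f] applies off the head only, so closure is shown for the part of [Z] with positive
   [eps]. *)
pose P := [set d | (0 < eps X i d)%N].
have PE d : (d \in P) = (0 < eps X i d)%N by rewrite in_set.
have : c \in Z :&: P.
  apply: (connect_f_rel_closed _ con) => [a b ab|].
    rewrite !in_setI !PE => /andP[aZ a0]; rewrite (sub_w_f hC ab a0 aZ).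
    by have /(f_rel_eps reg) -> : f_rel X i a b by apply/eqP.
  rewrite in_setI PE hZ'.
  by have /(f_rel_eps reg) -> : f_rel X i h h' by apply/eqP.
by rewrite in_setI => /andP[].
Qed.

Lemma ch_sub_w : ch Y = piK i (ch Z).
Proof.
have eqY : ch Y = \sum_(h in Y | eps X i h == 0%N)
    \sum_(c | connect (f_rel X i) h c) 'X_[wt X c].
  rewrite /ch (@sum_over_heads _ _ X i reg _ _ Y) => [|c cY]; last first.
    by apply/ZY/string_head_sub_w.
  apply: eq_bigr => h /andP[hY h0]; apply: eq_bigl => c.
  by rewrite andb_idl // => /string_sub_w <-.
(* Indexing by the heads in [Y] here too allows a comparison string by string. *)
have eqZ : ch Z = \sum_(h in Y | eps X i h == 0%N)
    \sum_(c | (c \in Z) && connect (f_rel X i) h c) 'X_[wt X c].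
  rewrite /ch (@sum_over_heads _ _ X i reg _ _ Y) // => c cZ.
  by apply/ZY/string_head_sub_w/ZY.
apply: piK_unique; rewrite eqY eqZ mulr_suml mulr_sumr.
rewrite (big_morph _ (msymD (simple_refl i)) (msym0 _ _)) -sumrB.
apply: eq_bigr => h /andP[hY /eqP h0].
case: (string_sum_sub_w (fun c => 'X_[wt X c] : {mpoly int[n]}) hY h0) => ->.
  exact: str_head.
(* For symmetric [S], (1 + y) x S - (1 + x) y S = (x - y) S. *)
have := str_symmetric h0; set S := \sum_(c | _) _ => symS.
rewrite !msymM msymD msym1 msym_x msym_y symS; ring.
Qed.

End Demazure.

Theorem theorem4p10 (m n : nat) (C : {set RPD m n})
    (hC : union_of_full_subcrystals C)
    (i : 'I_n.-1) (w : 'S_n) (hw : w (low i) < w (high i)) :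
  sub_w C (perm_comp w (simple_refl i)) = demazure C i (sub_w C w) /\
  ch (sub_w C (perm_comp w (simple_refl i))) = piK i (ch (sub_w C w)).
Proof. by split; [apply: sub_w_demazure|apply: ch_sub_w]. Qed.
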